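(* Let $\lambda\in\mathbb{N}_0^{N}$ with $\lambda_1\ge\lambda_2\ge\cdots\ge\lambda_N$, let $k\in\{0,1\}$ and $E\in\mathcal{E}_k$, and suppose that the tableau $\lfloor\lambda,E\rfloor$ is column-strict. Let $\mathcal{T}(\lambda,E)$ denote the set of pairs $(\alpha,F)$ with $\alpha\in\mathbb{N}_0^N$, $F\in\mathcal{E}_k$ and $\lfloor\alpha,F\rfloor=\lfloor\lambda,E\rfloor$. Then $$p_{\lambda,E}=\sum_{(\alpha,F)\in\mathcal{T}(\lambda,E)}\frac{\mathcal{R}_1(\alpha,F)}{\mathcal{C}_1^{(k)}(F)}\,J_{\alpha,F}$$ is supersymmetric, and it is the unique supersymmetric polynomial in $\mathcal{M}(\lambda,E)=\mathrm{span}\{J_{\beta,F}:\lfloor\beta,F\rfloor=\lfloor\lambda,E\rfloor\}$ whose coefficient of $x^\lambda$ is $$\sum_{F\in\mathcal{E}_k:\ \lfloor\lambda,F\rfloor=\lfloor\lambda,E\rfloor}\frac{1}{\mathcal{C}_1^{(k)}(F)}\,T_F .$$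
   Context: Fix integers $N\ge2$, $1\le m\le N-1$, and a real parameter $\kappa$ which is generic: $\kappa\ne a/n$ for all integers $a,n$ with $1\le n\le N$. Anticommuting variables. $\theta_1,\dots,\theta_N$ satisfy $\theta_i\theta_j=-\theta_j\theta_i$ for all $i,j$ (so $\theta_i^2=0$). For $E=\{i_1<\dots<i_r\}\subset\{1,\dots,N\}$ put $\phi_E=\theta_{i_1}\cdots\theta_{i_r}$; $E^C$ is the complement in $\{1,\dots,N\}$; $s(j,E)=\#\{i\in E: i>j\}$. $\mathcal{P}_m=\mathrm{span}\{\phi_E:\#E=m\}$. The commuting variables $x_1,\dots,x_N$ commute with each other and with all $\theta_j$; $x^\alpha=\prod_i x_i^{\alpha_i}$; $s\mathcal{P}_m=\mathrm{span}\{x^\alpha\phi_E:\alpha\in\mathbb{N}_0^N,\#E=m\}$. The symmetric group $\mathcal{S}_N$ acts by algebra automorphisms with $w x_i=x_{w(i)}$, $w\theta_i=\theta_{w(i)}$, i.e. $wp(x;\theta)=p(xw;\theta w)$ with $(xw)_i=x_{w(i)}$, $(\theta w)_i=\theta_{w(i)}$. It acts on $\mathbb{N}_0^N$ by $(w\alpha)_i=\alpha_{w^{-1}(i)}$. $s_i=(i,i+1)$. A polynomial $p\in s\mathcal{P}_m$ is supersymmetric if $wp=p$ for all $w\in\mathcal{S}_N$. The vectors $T_E$. $\mathcal{E}_0=\{E:\#E=m+1,\ N\in E\}$, $\mathcal{E}_1=\{E:\#E=m-1,\ N\notin E\}$. Contents: for $E\in\mathcal{E}_0$, $c(i,E)=-s(i,E)$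 if $i\in E$ and $c(i,E)=s(i,E^C)+1$ if $i\notin E$; for $E\in\mathcal{E}_1$, $c(i,E)=-1-s(i,E)$ if $i\in E$ and $c(i,E)=s(i,E^C)$ if $i\notin E$. For $E\in\mathcal{E}_0\cup\mathcal{E}_1$ there are vectors $T_E\in\mathcal{P}_m$ satisfying $\sum_{j>i}(i,j)T_E=c(i,E)T_E$ for $1\le i\le N$, normalized by: $T_{E_0}=\sum_{j\in E_0}(-1)^{s(j,E_0)}\phi_{E_0\setminus\{j\}}$ for $E_0=\{N-m,\dots,N\}\in\mathcal{E}_0$; $T_{E_1}=\sum_{j=m}^{N}\phi_{E_1\cup\{j\}}$ for $E_1=\{1,\dots,m-1\}\in\mathcal{E}_1$; and $T_{s_iE}=s_iT_E-(c(i,E)-c(i+1,E))^{-1}T_E$ whenever either $E\in\mathcal{E}_0$, $i\notin E$, $i+1\in E\setminus\{N\}$, or $E\in\mathcal{E}_1$, $i\in E$, $i+1\in E^C\setminus\{N\}$. (Here $s_iE$ is the image of the set $E$.) Nonsymmetric Jack polynomials. For $p\in s\mathcal{P}_m$, $$\mathcal{D}_ip=\frac{\partial p}{\partial x_i}+\kappa\sum_{j\ne i}\frac{p(x;\theta(i,j))-p(x(i,j);\theta(i,j))}{x_i-x_j},\qquad \mathcal{U}_ip=\mathcal{D}_i(x_ip)-\kappa\sum_{j=1}^{i-1}p(x(i,j);\theta(i,j)).$$ The $\mathcal{U}_i$ commute. For $\alpha\in\mathbb{N}_0^N$, $\alpha^+$ is its nonincreasing rearrangement and $r_\alpha\in\mathcal{S}_N$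 is $r_\alpha(i)=\#\{j:\alpha_j>\alpha_i\}+\#\{j\le i:\alpha_j=\alpha_i\}$. Write $\alpha\prec\beta$ if $\alpha\neq\beta$ and $\sum_{j\le i}\alpha_j\le\sum_{j\le i}\beta_j$ for all $i$; write $\alpha\lhd\beta$ if $\sum_i\alpha_i=\sum_i\beta_i$ and either $\alpha^+\prec\beta^+$, or $\alpha^+=\beta^+$ and $\alpha\prec\beta$. For $\alpha\in\mathbb{N}_0^N$ and $E\in\mathcal{E}_k$ ($k=0,1$), $J_{\alpha,E}$ is the unique polynomial of the form $x^\alpha\,(r_\alpha^{-1}T_E)+\sum_{\beta\lhd\alpha}x^\beta v_\beta(\theta)$, with $v_\beta\in\mathrm{span}\{T_F:F\in\mathcal{E}_k\}$, such that $\mathcal{U}_iJ_{\alpha,E}=(\alpha_i+1+\kappa c(r_\alpha(i),E))J_{\alpha,E}$ for $1\le i\le N$. Tableaux. For $E\in\mathcal{E}_0$, $Y_E$ is the filling of the hook Ferrers diagram of shape $(N-m,1^m)$ with the elements of $E$ in column 1, decreasing downwards (so $N$ is in cell $[1,1]$), and the elements of $E^C$ in cells $[1,2],[1,3],\dots$ of row 1, decreasing. For $E\in\mathcal{E}_1$, $Y_E$ is the filling of shape $(N-m+1,1^{m-1})$ with the elements of $E^C$ in row 1, decreasing (so $N$ is in $[1,1]$), and the elements of $E$ in cells $[2,1],[3,1],\dots$ of column 1, decreasing. $\lfloor\alpha,E\rfloor$ is obtained from $Y_E$ by replacing each entry $i$ by $\alpha^+_i$. It is column-strict if the entries in column 1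 are pairwise distinct (equivalently strictly increasing from top to bottom). Products. For $z\in\{0,1\}$, $$\mathcal{R}_z(\alpha,E)=\prod_{\substack{1\le i<j\le N\\ \alpha_i<\alpha_j}}\Bigl(1+\frac{(-1)^z\kappa}{\alpha_j-\alpha_i+\kappa(c(r_\alpha(j),E)-c(r_\alpha(i),E))}\Bigr),$$ $$\mathcal{C}^{(0)}_z(E)=\prod_{\substack{1\le i<j<N\\ i\in E,\,j\notin E}}\Bigl(1+\frac{(-1)^z}{c(i,E)-c(j,E)}\Bigr)\ (E\in\mathcal{E}_0),\qquad \mathcal{C}^{(1)}_z(F)=\prod_{\substack{1\le i<j<N\\ i\notin F,\,j\in F}}\Bigl(1+\frac{(-1)^z}{c(i,F)-c(j,F)}\Bigr)\ (F\in\mathcal{E}_1).$$ *)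

(* Defs.v *)
From HB Require Import structures.
From mathcomp Require Import all_boot all_order all_algebra all_fingroup.
From mathcomp.multinomials Require Import mpoly.

Set Implicit Arguments.
Unset Strict Implicit.
Unset Printing Implicit Defensive.

Import Order.TTheory GRing.Theory Num.Theory.

Local Open Scope ring_scope.

(* Indices 1..N are represented by 'I_N, the ordinal i standing for the index
   i.+1; in particular "i is the index N" reads i.+1 = N. *)

(* The Grassmann algebra over A in n anticommuting variables: the value of
   u : ext n A at E is the coefficient of phi_E in u (see ext_sum below).     *)

Section ExtDef.

Variables (n : nat) (A : comNzRingType).

Definition ext : Type := {ffun {set 'I_n} -> A}.

HB.instance Definition _ := GRing.Zmodule.on ext.

Implicit Types (u v w : ext) (E F G : {set 'I_n}).

Definition ext_scale (a : A) (u : ext) : ext := [ffun E => a * u E].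

Fact ext_scaleA a b u : ext_scale a (ext_scale b u) = ext_scale (a * b) u.
Proof. by apply/ffunP=> E; rewrite !ffunE mulrA. Qed.

Fact ext_scale1 : left_id 1 ext_scale.
Proof. by move=> u; apply/ffunP=> E; rewrite !ffunE mul1r. Qed.

Fact ext_scaleDr : right_distributive ext_scale +%R.
Proof. by move=> a u v; apply/ffunP=> E; rewrite !ffunE mulrDr. Qed.

Fact ext_scaleDl u : {morph ext_scale^~ u : a b / a + b}.
Proof. by move=> a b; apply/ffunP=> E; rewrite !ffunE mulrDl. Qed.

HB.instance Definition _ := GRing.Zmodule_isLmodule.Build A ext
  ext_scaleA ext_scale1 ext_scaleDr ext_scaleDl.

(* Number of transpositions needed to sort the concatenation of E and F. *)
Definition ninv E F : nat := (\sum_(i in E) \sum_(j in F) (j < i))%N.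

Definition ext_one : ext := [ffun E : {set 'I_n} => (E == set0)%:R].

Definition ext_mul u v : ext :=
  [ffun G : {set 'I_n} => \sum_(E : {set 'I_n} | E \subset G)
     (-1) ^+ ninv E (G :\: E) * u E * v (G :\: E)].

Lemma ninvUl E F G : [disjoint E & F] ->
  ninv (E :|: F) G = (ninv E G + ninv F G)%N.
Proof.
move=> dEF; rewrite /ninv -bigU //=.
by apply: eq_bigl => i; rewrite !inE.
Qed.

Lemma ninvUr E F G : [disjoint F & G] ->
  ninv E (F :|: G) = (ninv E F + ninv E G)%N.
Proof.
move=> dFG; rewrite /ninv -big_split /=.
by apply: eq_bigr => i _; rewrite -bigU //=; apply: eq_bigl => j; rewrite !inE.
Qed.

Fact ext_mulA : associative ext_mul.
Proof.
move=> u v w; apply/ffunP=> G; rewrite !ffunE.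
under eq_bigr => E sEG do rewrite ffunE big_distrr /=.
under [in RHS]eq_bigr => X sXG do rewrite ffunE mulr_sumr mulr_suml /=.
rewrite !pair_big_dep /=.
pose f (p : {set 'I_n} * {set 'I_n}) := (p.1 :|: p.2, p.1).
pose g (p : {set 'I_n} * {set 'I_n}) := (p.2, p.1 :\: p.2).
rewrite [RHS](reindex_onto f g) /=; last first.
  case=> X E /andP[/= _ sEX]; rewrite /f /g /=.
  by rewrite setDE setUIr setUCr setIT (setUidPr sEX).
have eqP1 (p : {set 'I_n} * {set 'I_n}) : (p.1 \subset G) && (p.2 \subset G :\: p.1) =
   [&& (f p).1 \subset G, (f p).2 \subset (f p).1 & g (f p) == p].
  case: p => E F; rewrite /f /g /= subUset subsetUl subsetD xpair_eqE eqxx /=.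
  rewrite setDUl setDv set0U -andbA disjoint_sym.
  by congr [&& _, _ & _]; rewrite disjoint_sym; apply/setDidPl/eqP.
rewrite (eq_bigl _ _ eqP1) [RHS](eq_bigl _ _ (fun p => esym (andbA _ _ _))).
apply: eq_bigr => [[E F]].
rewrite -eqP1 /= subsetD => /and3P[sEG sFG dFE].
have dEF : [disjoint E & F] by rewrite disjoint_sym.
set C := G :\: E :\: F.
have -> : (E :|: F) :\: E = F.
  by rewrite setDUl setDv set0U; apply/setDidPl.
have -> : G :\: (E :|: F) = C by rewrite /C setDDl.
have dFC : [disjoint F & C].
  by rewrite disjoints_subset /C setDE setCI setCK subsetUr.
have -> : G :\: E = F :|: C.
  rewrite /C [_ :\: F]setDE setUIr setUCr setIT; apply/esym/setUidPr.
  by rewrite subsetD sFG.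
rewrite ninvUr // ninvUl // !exprD.
set a := _ ^+ _; set b := _ ^+ _; set c := _ ^+ _.
rewrite !mulrA; congr (_ * _ * _).
by rewrite [LHS]mulrAC [b * c * a]mulrC mulrA.
Qed.

Fact ext_mul1l : left_id ext_one ext_mul.
Proof.
move=> u; apply/ffunP=> G; rewrite !ffunE (bigD1 set0) ?sub0set //= big1.
  by rewrite ffunE eqxx /ninv big_set0 mul1r setD0 mul1r addr0.
by move=> E /andP[_ /negPf nE]; rewrite ffunE nE mulr0 mul0r.
Qed.

Fact ext_mul1r : right_id ext_one ext_mul.
Proof.
move=> u; apply/ffunP=> G; rewrite !ffunE (bigD1 G) //= big1.
  rewrite ffunE setDv eqxx /ninv big1 ?expr0 ?mul1r ?mulr1 ?addr0 //.
  by move=> i _; rewrite big_set0.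
move=> E /andP[sEG nE]; rewrite ffunE setD_eq0.
by case: (boolP (G \subset E)) nE; rewrite ?mulr0 // eqEsubset sEG => ->.
Qed.

Fact ext_mulDl : left_distributive ext_mul +%R.
Proof.
move=> u v w; apply/ffunP=> G; rewrite !ffunE -big_split /=.
by apply: eq_bigr => E _; rewrite ffunE mulrDr mulrDl.
Qed.

Fact ext_mulDr : right_distributive ext_mul +%R.
Proof.
move=> u v w; apply/ffunP=> G; rewrite !ffunE -big_split /=.
by apply: eq_bigr => E _; rewrite ffunE mulrDr.
Qed.

Fact ext_1neq0 : ext_one != 0.
Proof.
apply/eqP=> /ffunP/(_ set0); rewrite !ffunE eqxx => /eqP.
by rewrite oner_eq0.
Qed.

HB.instance Definition _ := GRing.Zmodule_isNzRing.Build ext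
  ext_mulA ext_mul1l ext_mul1r ext_mulDl ext_mulDr ext_1neq0.

Fact ext_scaleAl a u v : a *: (u * v) = (a *: u) * v.
Proof.
apply/ffunP=> G; rewrite !ffunE mulr_sumr; apply: eq_bigr => E _.
by rewrite ffunE !mulrA [a * _]mulrC.
Qed.

Fact ext_scaleAr a u v : a *: (u * v) = u * (a *: v).
Proof.
apply/ffunP=> G; rewrite !ffunE mulr_sumr; apply: eq_bigr => E _.
by rewrite ffunE mulrCA.
Qed.

HB.instance Definition _ := GRing.Lmodule_isLalgebra.Build A ext ext_scaleAl.
HB.instance Definition _ := GRing.Lalgebra_isAlgebra.Build A ext ext_scaleAr.

Definition theta (i : 'I_n) : ext := [ffun E : {set 'I_n} => (E == [set i])%:R].

(* enum E lists the elements of E in increasing order. *)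
Definition phi (E : {set 'I_n}) : ext := \prod_(i <- enum E) theta i.

End ExtDef.

Arguments theta {n A} i.
Arguments phi {n A} E.

Section ExtTheory.

Variables (n : nat) (A : comNzRingType).

Implicit Types (u v w : ext n A) (E F G : {set 'I_n}).

Let basis E : ext n A := [ffun F : {set 'I_n} => (F == E)%:R].

Fact basisM E F : basis E * basis F =
  if [disjoint E & F] then (-1) ^+ ninv E F *: basis (E :|: F) else 0.
Proof.
apply/ffunP=> G; rewrite ffunE.
rewrite big_mkcond (bigD1 E) //= big1 => [|X nXE]; last first.
  by rewrite ffunE (negPf nXE) mulr0 mul0r if_same.
have k : (E \subset G) && (G :\: E == F) = [disjoint E & F] && (G == E :|: F).
  apply/andP/andP => [[sEG /eqP <-]|[dEF /eqP ->]].
    rewrite disjoint_sym disjoints_subset setDE subsetIr; split=> //.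
    by rewrite setUIr setUCr setIT (setUidPr sEG).
  rewrite subsetUl setDUl setDv set0U; split=> //.
  by apply/eqP/setDidPl; rewrite disjoint_sym.
rewrite addr0 !ffunE eqxx mulr1; case: [disjoint E & F] k => /= [k|].
  rewrite !ffunE -k; case: (E \subset G); rewrite ?mulr0 //=.
  by case: eqP => [->|]; rewrite ?mulr0.
by rewrite ffunE; case: (E \subset G) => //= ->; rewrite mulr0.
Qed.

Lemma phiE E : phi E = [ffun F : {set 'I_n} => (F == E)%:R] :> ext n A.
Proof.
have Hs (s : seq 'I_n) : sorted (fun i j : 'I_n => i < j)%N s ->
    \prod_(i <- s) theta i = basis [set i in s].
  elim: s => [|i s IHs] sis.
    have -> : [set j in [::]] = set0 :> {set 'I_n} by apply/setP=> j; rewrite !inE.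
    by rewrite big_nil.
  have lti : all (fun j : 'I_n => i < j)%N s.
    by apply: order_path_min sis => x y z; apply: ltn_trans.
  rewrite big_cons IHs ?(path_sorted sis) // [theta i]/(basis [set i]) basisM.
  have -> : [disjoint [set i] & [set j in s]].
    by rewrite disjoints1 inE; apply/negP => /(allP lti); rewrite ltnn.
  rewrite /ninv big_set1 big1 ?expr0 ?scale1r => [|j]; last first.
    by rewrite inE => /(allP lti) lij; rewrite ltnNge ltnW.
  by congr (basis _); apply/setP=> j; rewrite !inE.
rewrite /phi Hs.
  by congr (basis _); apply/setP=> j; rewrite inE mem_enum.
apply: sorted_filter; first by move=> x y z; apply: ltn_trans.
have := iota_ltn_sorted 0 n; rewrite -val_enum_ord sorted_map.
by rewrite enumT.
Qed.

Lemma ext_sum u : u = \sum_(E : {set 'I_n}) u E *: phi E.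
Proof.
apply/ffunP=> F; rewrite sum_ffunE (bigD1 F) //= big1 => [|E nEF].
  by rewrite phiE !ffunE eqxx mulr1 addr0.
by rewrite phiE !ffunE eq_sym (negPf nEF) mulr0.
Qed.

Lemma theta_anticomm i j : theta i * theta j = - (theta j * theta i) :> ext n A.
Proof.
rewrite [theta i]/(basis [set i]) [theta j]/(basis [set j]) !basisM.
rewrite !disjoints1 !inE eq_sym /ninv !big_set1 setUC.
case: eqVneq => [|nij]; first by rewrite oppr0.
by case: (ltngtP i j) nij => [||/val_inj->]; rewrite ?eqxx // expr0 expr1 scale1r scaleN1r ?opprK.
Qed.

Lemma theta_sqr i : theta i * theta i = 0 :> ext n A.
Proof.
by rewrite [theta i]/(basis [set i]) basisM disjoints1 inE eqxx.
Qed.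

End ExtTheory.

(* Superpolynomials: the coefficient of phi_E is a polynomial in x.           *)
Notation spoly N R := (ext N {mpoly R[N]}).

(* u(theta) |-> u(theta w), the coefficients being left unchanged.            *)
Definition theta_act (n : nat) (A : comNzRingType) (w : 'S_n) (u : ext n A) :
    ext n A :=
  \sum_(E : {set 'I_n}) u E *: \prod_(i <- enum E) theta (w i).

Section Superpolynomials.

Variables (N : nat) (R : comNzRingType).

Implicit Types (p q : spoly N R) (v : ext N R) (w : 'S_N).

(* p(x;theta) |-> p(xw;theta); msym w substitutes 'X_(w i) for 'X_i.          *)
Definition x_act w p : spoly N R :=
  [ffun E : {set 'I_N} => msym w (p E)].

Definition sym_act w p : spoly N R := theta_act w (x_act w p).

Definition ext_polyC v : spoly N R :=
  [ffun E : {set 'I_N} => (v E)%:MP_[N]].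

Definition x_coef (a : 'X_{1..N}) p : ext N R :=
  [ffun E : {set 'I_N} => mcoeff a (p E)].

Definition x_deriv (i : 'I_N) p : spoly N R :=
  [ffun E : {set 'I_N} => mderiv i (p E)].

Fact mdivdiff_subproof (i j : 'I_N) (f : {mpoly R[N]}) :
  exists g, ('X_i - 'X_j) * g = f - msym (tperm i j) f.
Proof.
have PM (f1 f2 : {mpoly R[N]}) :
    (exists g, ('X_i - 'X_j) * g = f1 - msym (tperm i j) f1) ->
    (exists g, ('X_i - 'X_j) * g = f2 - msym (tperm i j) f2) ->
    exists g, ('X_i - 'X_j) * g = f1 * f2 - msym (tperm i j) (f1 * f2).
  move=> [g1 E1] [g2 E2]; exists (g1 * f2 + msym (tperm i j) f1 * g2).
  by rewrite mulrDr mulrA E1 mulrCA E2 msymM mulrBl mulrBr addrA subrK.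
have PX k : exists g : {mpoly R[N]},
    ('X_i - 'X_j) * g = 'X_k - msym (tperm i j) 'X_k.
  rewrite msymX.
  have -> : [multinom U_(k)%MM ((tperm i j)^-1%g l) | l < N] = U_(tperm i j k)%MM.
    by apply/mnmP=> l; rewrite mnmE !mnm1E tpermV -(inj_eq (@perm_inj _ (tperm i j))) tpermK.
  case: tpermP => [->|->|_ _]; [exists 1 | exists (-1) | exists 0].
  - by rewrite mulr1.
  - by rewrite mulrN1 opprB.
  - by rewrite mulr0 subrr.
have P1 : exists g, ('X_i - 'X_j) * g = 1 - msym (tperm i j) (1 : {mpoly R[N]}).
  by exists 0; rewrite msym1 mulr0 subrr.
elim/mpolyind: f => [|c m f _ _ [g Eg]]; first by exists 0; rewrite msym0 mulr0 subrr.
have [h Eh] : exists g, ('X_i - 'X_j) * g = 'X_[m] - msym (tperm i j) 'X_[R, m].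
  have -> : 'X_[m] = \prod_(l < N) 'X_l ^+ m l :> {mpoly R[N]} by exact: mpolyXE_id.
  apply: (big_ind (fun f => exists g, ('X_i - 'X_j) * g = f - msym (tperm i j) f)) => // l _.
  elim: (m l) => [|e IHe]; first by rewrite expr0.
  by rewrite exprS; apply: PM.
exists (c *: h + g).
by rewrite mulrDr -scalerAr Eh Eg msymD msymZ scalerBr opprD addrACA.
Qed.

Fact divdiff_subproof (i j : 'I_N) p :
  exists q, ('X_i - 'X_j) *: q ==
    theta_act (tperm i j) p - sym_act (tperm i j) p.
Proof.
have H (E : {set 'I_N}) : exists g, ('X_i - 'X_j) * g == p E - msym (tperm i j) (p E).
  by have [g Eg] := mdivdiff_subproof i j (p E); exists g; apply/eqP.
exists (theta_act (tperm i j) [ffun E : {set 'I_N} => xchoose (H E)]).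
rewrite /sym_act /theta_act -sumrB scaler_sumr; apply/eqP/eq_bigr => E _.
by rewrite scalerA !ffunE (eqP (xchooseP (H E))) scalerBl.
Qed.

(* (p(x;theta(i,j)) - p(x(i,j);theta(i,j))) / (x_i - x_j); for i != j and
   coefficients in an integral domain, divdiffE determines this quotient. *)
Definition divdiff (i j : 'I_N) p : spoly N R := xchoose (divdiff_subproof i j p).

Lemma divdiffE i j p : ('X_i - 'X_j) *: divdiff i j p =
  theta_act (tperm i j) p - sym_act (tperm i j) p.
Proof. exact/eqP/(xchooseP (divdiff_subproof i j p)). Qed.

Definition dunkl (kappa : R) (i : 'I_N) p : spoly N R :=
  x_deriv i p + kappa%:MP_[N] *: \sum_(j < N | j != i) divdiff i j p.

Definition cherednik (kappa : R) (i : 'I_N) p : spoly N R :=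
  dunkl kappa i ('X_i *: p)
  - kappa%:MP_[N] *: \sum_(j < N | (j < i)%N) sym_act (tperm i j) p.

Definition supersymmetric (m : nat) p : Prop :=
  (forall E : {set 'I_N}, #|E| != m -> p E = 0)
  /\ (forall w, sym_act w p = p).

End Superpolynomials.

Section Compositions.

Variable N : nat.

Implicit Types (a b : 'X_{1..N}).

Definition is_partition a : Prop := forall i j : 'I_N, (i <= j)%N -> (a j <= a i)%N.

Definition comp_sort a : 'X_{1..N} :=
  [multinom nth 0%N (sort geq a) i | i < N].

(* r_alpha; with indices starting at 0 the term j = i of the second cardinal is dropped. *)
Definition rank a (i : 'I_N) : nat :=
  (#|[set j : 'I_N | a i < a j]| + #|[set j : 'I_N | (j < i) && (a j == a i)]|)%N.

Let above a (i : 'I_N) :=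
  [set j : 'I_N | (a i < a j) || ((j < i) && (a j == a i))]%N.

Fact rankE a i : rank a i = #|above a i|.
Proof.
rewrite /rank -cardsUI.
set I := _ :&: _; have -> : I = set0.
  by apply/setP=> j; rewrite !inE; case: ltngtP; rewrite ?andbF.
rewrite cards0 addn0.
by apply: eq_card => j; rewrite !inE.
Qed.

Fact rank_lt a i : (rank a i < N)%N.
Proof.
rewrite rankE -[X in (_ < X)%N]card_ord -cardsT; apply: proper_card.
by rewrite properT; apply/negP => /eqP/setP/(_ i); rewrite !inE !ltnn.
Qed.

Fact rank_inj a : injective (fun i => Ordinal (rank_lt a i)).
Proof.
move=> i j [/eqP]; apply: contraTeq => nij.
wlog lt_ij : i j nij / (a j < a i)%N || (i < j)%N && (a i == a j).
  move=> H.
  have [lt|lt|e] := ltngtP (a i) (a j).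
  - by rewrite eq_sym; apply: H; rewrite 1?eq_sym ?lt.
  - by apply: H; rewrite ?lt.
  have [lt|lt|/val_inj e'] := ltngtP i j; last by rewrite e' eqxx in nij.
  - by apply: H; rewrite ?lt ?e ?eqxx ?orbT.
  - by rewrite eq_sym; apply: H; rewrite 1?eq_sym // lt e eqxx orbT.
rewrite neq_ltn !rankE; apply/orP; left; apply: proper_card.
apply/properP; split; last first.
  by exists i; rewrite !inE ?ltnn //=.
apply/subsetP=> l; rewrite !inE.
case/orP: lt_ij => [lt|/andP[lt /eqP <-]].
  case/orP => [lt'|/andP[_ /eqP ->]]; by rewrite ?lt ?(ltn_trans lt lt').
by case/orP => [->//|/andP[lt' ->]]; rewrite (ltn_trans lt' lt) orbT.
Qed.

Definition rank_perm a : 'S_N := perm (@rank_inj a).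

(* Dominance order; the total degrees are not required to agree. *)
Definition dom_lt a b : bool :=
  (a != b) && [forall i : 'I_N,
    \sum_(j < N | (j <= i)%N) a j <= \sum_(j < N | (j <= i)%N) b j]%N.

Definition comp_lt a b : bool :=
  (mdeg a == mdeg b) &&
  (dom_lt (comp_sort a) (comp_sort b)
   || ((comp_sort a == comp_sort b) && dom_lt a b)).

End Compositions.

(* Below, k : bool is the index k in {0,1}; hook_sets k is the set E_k. *)
Section Hooks.

Variables (N m : nat).

Implicit Types (k : bool) (E F : {set 'I_N}) (a : 'X_{1..N}).

Definition hook_sets k : {set {set 'I_N}} :=
  if k then [set E : {set 'I_N} | (#|E| == m.-1) && [forall i in E, i.+1 != N]]
  else [set E : {set 'I_N} | (#|E| == m.+1) && [exists i in E, i.+1 == N]].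

Definition gt_count (i : 'I_N) E : nat := #|[set j in E | (i < j)%N]|.

Definition content k (i : 'I_N) E : int :=
  if k then (if i \in E then - 1 - (gt_count i E)%:Z else (gt_count i (~: E))%:Z)
  else (if i \in E then - (gt_count i E)%:Z else (gt_count i (~: E))%:Z + 1).

(* A filling of a hook is given by its first column and its first row, both
   including the corner cell. *)
Definition hook_filling k E : seq 'I_N * seq 'I_N :=
  let dE := rev (enum E) in
  let dC := rev (enum (~: E)) in
  if k then (take 1 dC ++ dE, dC) else (dE, take 1 dE ++ dC).

Definition tableau k a E : seq nat * seq nat :=
  let Y := hook_filling k E in
  (map (comp_sort a) Y.1, map (comp_sort a) Y.2).

Definition column_strict (t : seq nat * seq nat) : bool := uniq t.1.

(* Pairs (a, F) with the same tableau as (lam, E): such an a is a rearrangement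
   of lam, so bounding its degree loses nothing. *)
Definition same_tableau k (lam : 'X_{1..N}) E :
    {set 'X_{1..N < (mdeg lam).+1} * {set 'I_N}} :=
  [set aF : 'X_{1..N < (mdeg lam).+1} * {set 'I_N} |
    (aF.2 \in hook_sets k) && (tableau k aF.1 aF.2 == tableau k lam E)].

End Hooks.

Section Jack.

Variables (N m : nat) (R : realFieldType) (kappa : R).

Implicit Types (k : bool) (E F : {set 'I_N}) (a : 'X_{1..N}).

Definition generic : Prop :=
  forall (a : int) (n : nat), (1 <= n <= N)%N -> kappa != a%:~R / n%:R.

Definition hook_vectors k (T : {set 'I_N} -> ext N R) : Prop :=
  let c i E : R := (content k i E)%:~R in
  [/\ forall E, E \in hook_sets N m k ->
        forall F, #|F| != m -> T E F = 0,
      forall E, E \in hook_sets N m k -> forall i : 'I_N,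
        \sum_(j < N | (i < j)%N) theta_act (tperm i j) (T E) = c i E *: T E,
      if k then
        let E1 := [set i : 'I_N | (i.+1 <= m.-1)%N] in
        T E1 = \sum_(j < N | (m <= j.+1)%N) phi (j |: E1)
      else
        let E0 := [set i : 'I_N | (N - m <= i.+1)%N] in
        T E0 = \sum_(j in E0) (-1) ^+ gt_count j E0 *: phi (E0 :\ j)
    & forall E, E \in hook_sets N m k -> forall i j : 'I_N, j = i.+1 :> nat ->
        (if k then (i \in E) && (j \notin E) else (i \notin E) && (j \in E)) ->
        j.+1 != N ->
        T (tperm i j @: E) =
          theta_act (tperm i j) (T E) - (c i E - c j E)^-1 *: T E].

Definition hook_span k (T : {set 'I_N} -> ext N R) (v : ext N R) : Prop :=
  exists b : {set 'I_N} -> R, v = \sum_(F in hook_sets N m k) b F *: T F.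

(* As comp_lt only relates compositions of the same degree, the degree bound on
   b is no restriction. *)
Definition is_nsjack k (T : {set 'I_N} -> ext N R) a E (p : spoly N R) : Prop :=
  (exists v : 'X_{1..N} -> ext N R,
     (forall b, hook_span k T (v b)) /\
     p = 'X_[a] *: ext_polyC (theta_act (rank_perm a)^-1%g (T E))
         + \sum_(b : 'X_{1..N < (mdeg a).+1} | comp_lt b a)
             'X_[b] *: ext_polyC (v b))
  /\ (forall i : 'I_N, cherednik kappa i p =
        ((a i)%:R + 1 + kappa * (content k (rank_perm a i) E)%:~R)%:MP_[N] *: p).

Definition nsjack_span k (J : 'X_{1..N} -> {set 'I_N} -> spoly N R)
    (lam : 'X_{1..N}) E (p : spoly N R) : Prop :=
  exists b : 'X_{1..N} -> {set 'I_N} -> R,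
    p = \sum_(aF in same_tableau m k lam E)
          (b aF.1 aF.2)%:MP_[N] *: J aF.1 aF.2.

Definition R_prod (z : nat) k a E : R :=
  \prod_(i < N) \prod_(j < N | (i < j)%N && (a i < a j)%N)
    (1 + (-1) ^+ z * kappa /
       ((a j)%:R - (a i)%:R
        + kappa * ((content k (rank_perm a j) E)%:~R
                   - (content k (rank_perm a i) E)%:~R))).

Definition C_prod (z : nat) k E : R :=
  \prod_(i < N) \prod_(j < N | [&& (i < j)%N, j.+1 < N
      & if k then (i \notin E) && (j \in E) else (i \in E) && (j \notin E)]%N)
    (1 + (-1) ^+ z / ((content k i E)%:~R - (content k j E)%:~R)).

Definition superjack k (J : 'X_{1..N} -> {set 'I_N} -> spoly N R)
    (lam : 'X_{1..N}) E : spoly N R :=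
  \sum_(aF in same_tableau m k lam E)
    (R_prod 1 k aF.1 aF.2 / C_prod 1 k aF.2)%:MP_[N] *: J aF.1 aF.2.

Definition lead_vector k (T : {set 'I_N} -> ext N R) (lam : 'X_{1..N}) E :
    ext N R :=
  \sum_(F in hook_sets N m k | tableau k lam F == tableau k lam E)
    (C_prod 1 k F)^-1 *: T F.

End Jack.

(* Main.v *)
Require Import Defs.
From HB Require Import structures.
From mathcomp Require Import all_boot all_order all_algebra all_fingroup.
From mathcomp.multinomials Require Import mpoly.
From mathcomp Require Import zify ring.

Set Implicit Arguments.
Unset Strict Implicit.
Unset Printing Implicit Defensive.

Import Order.TTheory GRing.Theory Num.Theory.

Local Open Scope ring_scope.

(** Everything is deduced from two facts about the Cherednik operators U_i:
    they are triangular, and for neighbours i, j = i + 1 the transposition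
    s = (i j) satisfies s U_i = U_j s + kappa and commutes with the other U_l.

    Triangularity ([x_coef_cherednik_top]).  Monomials are compared by a single
    natural number, [height].  If x^b is highest in a polynomial p, the
    coefficient of x^b in U_i p is b_i + 1 plus kappa times a Jucys-Murphy
    element, conjugated by r_b, applied to the coefficient of x^b in p.  Hence
    ([spectrum]) a nonzero joint eigenvector with coefficients in the span of
    the T_F has, at its highest monomial, the eigenvalues attached to some pair
    (b, F), and for generic kappa these determine the pair.  So J_(a,E) is the
    only joint eigenvector with its eigenvalues and its coefficient at x^a
    ([jack_unique]), and its other monomials are lower than x^a.

    For this the span of the T_F has to be stable under the symmetric group,
    which is not part of their description.  It is: up to lower terms T_F is a
    multiple of an explicit product ([T_expand]), and these products span an
    invariant space, the part of the right degree of the algebra generated by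
    the differences theta_i - theta_N for k = 0, of the ideal generated by
    the sum of all theta_i for k = 1 ([hspan_theta_act]).

    Steps.  If p is a joint eigenvector with eigenvalues z, then s p - b p with
    b = kappa / (z_i - z_j) is one with z_i and z_j exchanged ([eigen_step]).
    By uniqueness s J = J' + b J, where J' belongs to the pair obtained by
    exchanging a_i and a_j, or, if a_i = a_j, by exchanging two neighbouring
    entries of the tableau that lie in different arms of the hook.  If these
    entries lie in the row, the exchanged eigenvalues do not occur, so
    s J = J; they cannot both lie in the column since the tableau is
    column-strict.

    Symmetry.  When s J = J' + b J with s an involution, the combination
    A J + A' J' is fixed by s as soon as A = (1 + b) A' ([invariant_pair]).  The
    coefficients R_1 / C_1 of J and J' differ exactly by the factor 1 + b
    ([jack_coef_ascent], [jack_coef_upward]), so each summand of p together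
    with its partner is fixed by s, and p is symmetric.

    Uniqueness.  In a symmetric combination of the J that lacks x^lambda, the
    highest monomial is a permutation of x^lambda and so has coefficient zero;
    this kills the top terms because the T_F are eigenvectors with distinct
    content vectors ([sum_jack_eq0]). *)

(** * The symmetric group acting on the Grassmann algebra *)

Definition anticommuting (I : Type) (B : nzRingType) (y : I -> B) : Prop :=
  (forall i j, y i * y j = - (y j * y i)) /\ (forall i, y i * y i = 0).

Lemma anticomm_prod (I : Type) (B : nzRingType) (y : I -> B) z (s : seq I) :
  (forall i, z * y i = - (y i * z)) ->
  z * \prod_(i <- s) y i = (-1) ^+ size s * (\prod_(i <- s) y i * z).
Proof.
move=> Hz; elim: s => [|i s IHs]; first by rewrite big_nil expr0 !mul1r mulr1.
rewrite big_cons mulrA Hz mulNr -[_ * z * _]mulrA IHs /= exprS -!mulrA mulN1r.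
by congr (- _); rewrite !mulrA (commr_sign (y i)).
Qed.

(** The sign is that of the rearrangement, hence the same for all families: it can
    be carried from the theta_i to their images under a permutation of the indices. *)
Lemma anticomm_perm (I : eqType) (s t : seq I) : perm_eq s t ->
  exists e : nat, forall (B : nzRingType) (y : I -> B), anticommuting y ->
    \prod_(i <- s) y i = (-1) ^+ e * \prod_(i <- t) y i.
Proof.
elim: s t => [|x s IHs] t.
  by rewrite perm_sym => /perm_nilP ->; exists 0%N => B y _; rewrite !big_nil mulr1.
move=> pst; have xt : x \in t by rewrite -(perm_mem pst) inE eqxx.
case/splitPr: xt pst => p1 p2 pst.
have /IHs[e He] : perm_eq s (p1 ++ p2).
  by rewrite -(perm_cons x) (perm_trans pst) // perm_sym -cat1s perm_catCA.
exists (size p1 + e)%N => B y yac; rewrite big_cons (He B y yac) !big_cat big_cons /=.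
set P1 := \prod_(i <- p1) y i; set P2 := \prod_(i <- p2) y i.
have -> : y x * ((-1) ^+ e * (P1 * P2)) = (-1) ^+ e * (y x * P1 * P2).
  by rewrite mulrA (commr_sign (y x)) !mulrA.
by rewrite (@anticomm_prod _ _ _ _ p1 (yac.1 x)) -/P1 addnC exprD !mulrA.
Qed.

Lemma anticomm_nuniq (I : eqType) (B : nzRingType) (y : I -> B) (s : seq I) :
  anticommuting y -> ~~ uniq s -> \prod_(i <- s) y i = 0.
Proof.
move=> yac; elim: s => //= x s IHs; rewrite negb_and negbK big_cons.
case/orP=> [xs|/IHs ->]; last by rewrite mulr0.
have [e ->//] := anticomm_perm (perm_to_rem xs).
by rewrite big_cons mulrA (commr_sign (y x)) -mulrA [y x * _]mulrA yac.2 mul0r mulr0.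
Qed.

Section ThetaAction.

Variables (n : nat) (A : comNzRingType).

Implicit Types (u v : ext n A) (E F : {set 'I_n}) (w : 'S_n).

Lemma theta_anticommuting : anticommuting (@theta n A).
Proof. by split=> *; [apply: theta_anticomm | apply: theta_sqr]. Qed.

Lemma theta_act_is_linear w : linear (@theta_act n A w).
Proof.
move=> a u v; rewrite /theta_act scaler_sumr -big_split; apply: eq_bigr => E _ /=.
by rewrite scalerA -scalerDl !ffunE.
Qed.

HB.instance Definition _ w :=
  GRing.isLinear.Build A (ext n A) (ext n A) *:%R (@theta_act n A w) (theta_act_is_linear w).

Lemma theta_act_phi w E : theta_act w (phi E) = \prod_(i <- enum E) theta (w i) :> ext n A.
Proof.
rewrite /theta_act (bigD1 E) //= [X in _ + X]big1 => [|F nEF]; rewrite phiE ffunE.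
  by rewrite eqxx scale1r addr0.
by rewrite (negPf nEF) scale0r.
Qed.

(** [theta_act] is defined on increasing words only; arbitrary words are needed to
    see that it is multiplicative and compatible with composition. *)
Lemma theta_act_prod w (s : seq 'I_n) :
  theta_act w (\prod_(i <- s) theta i) = \prod_(i <- s) theta (w i) :> ext n A.
Proof.
have wac : anticommuting (fun i => @theta n A (w i)).
  by split=> *; [apply: theta_anticomm | apply: theta_sqr].
have [us|nus] := boolP (uniq s); last first.
  by rewrite (anticomm_nuniq theta_anticommuting) // (anticomm_nuniq wac) // raddf0.
have ps : perm_eq s (enum [set i in s]).
  by apply: uniq_perm; rewrite ?enum_uniq // => i; rewrite mem_enum inE.
have [e He] := anticomm_perm ps.
rewrite (He _ _ theta_anticommuting) (He _ _ wac) -signr_odd !mulr_sign.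
by case: odd; rewrite ?raddfN /= theta_act_phi.
Qed.

Lemma theta_act_theta w i : theta_act w (theta i) = theta (w i) :> ext n A.
Proof. by have := theta_act_prod w [:: i]; rewrite !big_cons !big_nil !mulr1. Qed.

Lemma theta_actM w u v : theta_act w (u * v) = theta_act w u * theta_act w v.
Proof.
rewrite (ext_sum u) (ext_sum v) mulr_suml !raddf_sum /= mulr_suml.
apply: eq_bigr => E _; rewrite mulr_sumr !raddf_sum /= mulr_sumr.
apply: eq_bigr => F _; rewrite -scalerAl -scalerAr !linearZ_LR /= -scalerAl -scalerAr.
by rewrite /phi -big_cat !theta_act_prod big_cat.
Qed.

Lemma eq_linear_phi (f g : {linear ext n A -> ext n A}) :
  (forall E, f (phi E) = g (phi E)) -> f =1 g.
Proof.
move=> fg u; rewrite [u in LHS]ext_sum [u in RHS]ext_sum !linear_sum.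
by apply: eq_bigr => E _; rewrite !linearZ_LR /= fg.
Qed.

Lemma theta_act_comp s t u : theta_act t (theta_act s u) = theta_act (s * t)%g u.
Proof.
apply: (eq_linear_phi (f := theta_act t \o theta_act s)) => E /=; rewrite !theta_act_phi.
have -> : \prod_(i <- enum E) theta (s i) = \prod_(i <- map s (enum E)) theta i :> ext n A.
  by rewrite big_map.
rewrite theta_act_prod big_map.
by apply: eq_bigr => i _; rewrite permM.
Qed.

Lemma theta_act1 u : theta_act 1%g u = u.
Proof.
rewrite [RHS]ext_sum /theta_act; apply: eq_bigr => E _; congr (_ *: _).
by apply: eq_bigr => i _; rewrite perm1.
Qed.

Lemma theta_actK w u : theta_act w (theta_act w^-1%g u) = u.
Proof. by rewrite theta_act_comp mulVg theta_act1. Qed.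

Lemma theta_actVK w u : theta_act w^-1%g (theta_act w u) = u.
Proof. by rewrite theta_act_comp mulgV theta_act1. Qed.

End ThetaAction.

(** * The symmetric group acting on superpolynomials *)

Local Notation "m # s" := [multinom (m : 'X_{1.._}) (s i) | i < _]
  (at level 40, left associativity, format "m # s").

Section Superpolynomials.

Variables (N : nat) (R : comNzRingType).

Implicit Types (p q : spoly N R) (v : ext N R) (w s t : 'S_N) (b : 'X_{1..N}).

Lemma x_coef_is_additive b : additive (@x_coef N R b).
Proof. by move=> p q; apply/ffunP=> E; rewrite !ffunE mcoeffB. Qed.

HB.instance Definition _ b :=
  GRing.isAdditive.Build (spoly N R) (ext N R) (@x_coef N R b) (x_coef_is_additive b).

(** Superpolynomials are handled through their coefficients at the monomials x^b,
    which are elements of the Grassmann algebra over the scalars. *)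
Lemma x_coefP p q : (forall b, x_coef b p = x_coef b q) -> p = q.
Proof.
move=> pq; apply/ffunP=> E; apply/mpolyP=> b.
by have /ffunP/(_ E) := pq b; rewrite !ffunE.
Qed.

Lemma x_coefZ b c p : x_coef b (c%:MP_[N] *: p) = c *: x_coef b p.
Proof. by apply/ffunP=> E; rewrite !ffunE mcoeffCM. Qed.

Lemma x_coefX b a v : x_coef b ('X_[a] *: ext_polyC v) = (a == b)%:R *: v.
Proof. by apply/ffunP=> E; rewrite !ffunE mulrC mcoeffCM mcoeffX mulrC. Qed.

Lemma x_coef_polyC b (f : {mpoly R[N]}) v : x_coef b (f *: ext_polyC v) = f@_b *: v.
Proof. by apply/ffunP=> E; rewrite !ffunE mulrC mcoeffCM mulrC. Qed.

Lemma ext_polyC_theta i : ext_polyC (theta i) = theta i :> spoly N R.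
Proof. by apply/ffunP=> E; rewrite !ffunE; case: eqP; rewrite ?mpolyC1 ?mpolyC0. Qed.

Lemma ext_polyC_prod_theta w (l : seq 'I_N) :
  ext_polyC (\prod_(i <- l) theta (w i)) = \prod_(i <- l) theta (w i) :> spoly N R.
Proof.
elim: l => [|i l IHl].
  rewrite !big_nil; apply/ffunP=> E.
  by rewrite !ffunE; case: eqP; rewrite ?mpolyC1 ?mpolyC0.
rewrite !big_cons -IHl -ext_polyC_theta; apply/ffunP=> E; rewrite !ffunE rmorph_sum.
by apply: eq_bigr => F _; rewrite !rmorphM /= rmorph_sign !ffunE; reflexivity.
Qed.

Lemma x_coef_theta_act b w p : x_coef b (theta_act w p) = theta_act w (x_coef b p).
Proof.
rewrite /theta_act raddf_sum; apply: eq_bigr => E _ /=.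
by rewrite -ext_polyC_prod_theta x_coef_polyC ffunE.
Qed.

Lemma x_coef_x_act b w p : x_coef b (x_act w p) = x_coef (b#w) p.
Proof. by apply/ffunP=> E; rewrite !ffunE mcoeff_sym. Qed.

(** With the action of theta alone, this reduces identities between actions to
    identities in the Grassmann algebra and between exponents. *)
Lemma x_coef_sym_act b w p : x_coef b (sym_act w p) = theta_act w (x_coef (b#w) p).
Proof. by rewrite x_coef_theta_act x_coef_x_act. Qed.

Lemma sym_act_is_additive w : additive (@sym_act N R w).
Proof. by move=> p q; apply: x_coefP => b; rewrite x_coef_sym_act !raddfB /= !x_coef_sym_act. Qed.

HB.instance Definition _ w :=
  GRing.isAdditive.Build (spoly N R) (spoly N R) (@sym_act N R w) (sym_act_is_additive w).

Lemma sym_actZ w (f : {mpoly R[N]}) p :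
  sym_act w (f *: p) = msym w f *: sym_act w p.
Proof.
rewrite /sym_act -linearZ; congr theta_act.
by apply/ffunP=> E; rewrite !ffunE msymM.
Qed.

Lemma msymC w c : msym w c%:MP = c%:MP :> {mpoly R[N]}.
Proof. by rewrite -[c%:MP]mulr1 mul_mpolyC msymZ msym1. Qed.

Lemma sym_actZC w c p : sym_act w (c%:MP_[N] *: p) = c%:MP_[N] *: sym_act w p.
Proof. by rewrite sym_actZ msymC. Qed.

Lemma msymXU w i : msym w 'X_i = 'X_(w i) :> {mpoly R[N]}.
Proof.
rewrite msymX; congr 'X_[_]; apply/mnmP=> l; rewrite mnmE !mnm1E.
by rewrite -(inj_eq (@perm_inj _ w)) permKV.
Qed.

Lemma sym_act_comp s t p : sym_act t (sym_act s p) = sym_act (s * t)%g p.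
Proof. by apply: x_coefP => b; rewrite !x_coef_sym_act theta_act_comp mpermM. Qed.

Lemma sym_act1 p : sym_act 1%g p = p.
Proof. by apply: x_coefP => b; rewrite x_coef_sym_act theta_act1 mperm1. Qed.

Lemma sym_act_theta_act s t p :
  sym_act t (theta_act s p) = theta_act (s ^ t)%g (sym_act t p).
Proof.
apply: x_coefP => b; rewrite !(x_coef_sym_act, x_coef_theta_act) !theta_act_comp.
by rewrite -conjgC.
Qed.

Lemma sym_act_deriv w i p : sym_act w (x_deriv i p) = x_deriv (w i) (sym_act w p).
Proof.
have coef_deriv j q b : x_coef b (x_deriv j q) = (b j).+1%:R *: x_coef (b + U_(j)) q.
  by apply/ffunP=> E; rewrite !ffunE mcoeff_deriv mulr_natl.
apply: x_coefP => b; rewrite x_coef_sym_act !coef_deriv x_coef_sym_act linearZ /= mnmE.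
have -> // : (b + U_(w i))%MM#w = (b#w + U_(i))%MM.
by apply/mnmP=> l; rewrite !(mnmE, mnmDE, mnm1E) (inj_eq perm_inj).
Qed.

End Superpolynomials.

(** * Exchange relations of the Cherednik operators *)

Section Cherednik.

Variables (N : nat) (R : comNzRingType) (kappa : R).

Implicit Types (p q : spoly N R) (i j l : 'I_N) (w : 'S_N).

Local Notation tact i j := (theta_act (tperm i j)).
Local Notation act i j := (sym_act (tperm i j)).
Local Notation D := (dunkl kappa).
Local Notation U := (cherednik kappa).

(** The leading coefficient is 1 or -1.  This makes divided differences unique. *)
Lemma subX_lreg i j : i != j -> GRing.lreg ('X_i - 'X_j : {mpoly R[N]}).
Proof.
move=> nij; apply: lreg_mleadc; set f := 'X_i - 'X_j.
have coef l : f@_U_(l) = (i == l)%:R - (j == l)%:R by rewrite mcoeffB !mcoeffXU.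
have f0 : f != 0.
  apply: contraNneq (oner_neq0 R) => f0; have := coef i.
  by rewrite f0 mcoeff0 eqxx eq_sym (negPf nij) subr0 => /eqP; rewrite eq_sym.
have := msuppB_le (mlead_supp f0); rewrite mem_cat !msuppX !inE => /orP[] /eqP->.
  by rewrite coef eqxx eq_sym (negPf nij) subr0; apply: lreg1.
by rewrite coef eqxx (negPf nij) sub0r; apply/lregN/lreg1.
Qed.

Lemma scale_subX_inj i j p q : i != j ->
  ('X_i - 'X_j) *: p = ('X_i - 'X_j) *: q -> p = q.
Proof.
move=> nij /ffunP pq; apply/ffunP=> E; have := pq E; rewrite !ffunE.
exact: subX_lreg.
Qed.

Lemma divdiff_unique i j p q : i != j ->
  ('X_i - 'X_j) *: q = tact i j p - act i j p -> divdiff i j p = q.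
Proof. by move=> nij Hq; apply: (scale_subX_inj nij); rewrite divdiffE Hq. Qed.

Lemma sym_act_divdiff w i j p : i != j ->
  sym_act w (divdiff i j p) = divdiff (w i) (w j) (sym_act w p).
Proof.
move=> nij; apply/esym/divdiff_unique; first by rewrite (inj_eq perm_inj).
have -> : 'X_(w i) - 'X_(w j) = msym w ('X_i - 'X_j) :> {mpoly R[N]}.
  by rewrite msymB !msymXU.
rewrite -sym_actZ [X in sym_act w X]divdiffE raddfB /=.
rewrite [X in X - _]sym_act_theta_act tpermJ; congr (_ - _).
by rewrite !sym_act_comp conjgC tpermJ.
Qed.

(** The Dunkl operators treat all indices alike, so conjugation just permutes them. *)
Lemma sym_act_dunkl w i p : sym_act w (D i p) = D (w i) (sym_act w p).
Proof.
rewrite /dunkl raddfD /= sym_act_deriv sym_actZC; congr (_ + _ *: _).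
rewrite (raddf_sum (sym_act w)).
rewrite [RHS](reindex_inj (@perm_inj _ w)) /=.
apply: eq_big => j; first by rewrite (inj_eq perm_inj).
by move=> nji; rewrite sym_act_divdiff // eq_sym.
Qed.

Lemma sym_act_dunklX w i p :
  sym_act w (D i ('X_i *: p)) = D (w i) ('X_(w i) *: sym_act w p).
Proof. by rewrite sym_act_dunkl sym_actZ msymXU. Qed.

Lemma sym_act_tperm w i j p : sym_act w (act i j p) = act (w i) (w j) (sym_act w p).
Proof. by rewrite !sym_act_comp conjgC tpermJ. Qed.

Section Adjacent.

Variables (i j : 'I_N).
Hypothesis ij : j = i.+1 :> nat.

Let ltij l : (l < j)%N = (l < i)%N || (l == i).
Proof. by rewrite ij ltnS leq_eqVlt orbC -(inj_eq val_inj). Qed.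

Let nij : i != j.
Proof. by rewrite -(inj_eq val_inj) /= ij neq_ltn ltnSn. Qed.

Let sum_ltj (F : 'I_N -> spoly N R) :
  \sum_(l < N | (l < j)%N) F l = F i + \sum_(l < N | (l < i)%N) F l.
Proof.
rewrite (bigD1 i) ?ltij ?eqxx ?orbT //=; congr (_ + _); apply: eq_bigl => l.
by rewrite ltij; case: eqVneq => [->|]; rewrite ?ltnn ?andbT ?orbF ?andbF.
Qed.

Let tperm_lt l : (l < i)%N -> tperm i j l = l.
Proof.
by move=> li; rewrite tpermD // -(inj_eq val_inj) /= neq_ltn ?ij ?li ?ltnS ?(ltnW li) ?orbT.
Qed.

Let act_sum m p :
  act i j (\sum_(l < N | (l < i)%N) act m l p) =
  \sum_(l < N | (l < i)%N) act (tperm i j m) l (act i j p).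
Proof.
rewrite (raddf_sum (act i j)); apply: eq_bigr => l li /=.
by rewrite sym_act_tperm (tperm_lt li).
Qed.

(** The only part of the operator that is not permuted with the indices is the
    last sum; exchanging neighbours gives or loses the one term (i j). *)
Lemma sym_act_cherednik_l p : act i j (U i p) = U j (act i j p) + kappa%:MP_[N] *: p.
Proof.
rewrite /cherednik raddfB /= sym_act_dunklX sym_actZC tpermL sum_ltj act_sum tpermL.
have -> : act j i (act i j p) = p.
  by rewrite [tperm j i]tpermC sym_act_comp tperm2 sym_act1.
by rewrite scalerDr opprD addrA addrAC subrK.
Qed.

(** The previous relation conjugated by the transposition. *)
Lemma sym_act_cherednik_r p : act i j (U j p) = U i (act i j p) - kappa%:MP_[N] *: p.
Proof.
have actK q : act i j (act i j q) = q by rewrite sym_act_comp tperm2 sym_act1.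
have := etrans (sym_act_cherednik_l (act i j p))
  (congr1 (fun q => U j q + kappa%:MP_[N] *: act i j p) (actK p)).
move: (U i (act i j p)) (U j p) => x y e.
have -> : y = act i j x - kappa%:MP_[N] *: act i j p by rewrite e addrK.
by rewrite raddfB /= sym_actZC !actK.
Qed.

Lemma sym_act_cherednik_far l p : l != i -> l != j ->
  act i j (U l p) = U l (act i j p).
Proof.
move=> li lj; have tl : tperm i j l = l by rewrite tpermD // eq_sym.
rewrite /cherednik raddfB /= sym_act_dunklX sym_actZC tl; congr (_ - _ *: _).
rewrite [RHS](reindex_inj (@perm_inj _ (tperm i j))) /= (raddf_sum (act i j)) /=.
apply: eq_big => [m|m _]; last by rewrite sym_act_tperm tl.
have {}li : (l != i :> nat) by [].
have {}lj : (l != j :> nat) by [].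
by case: tpermP => // ->; lia.
Qed.

End Adjacent.

Lemma divdiffD i j p q : i != j -> divdiff i j (p + q) = divdiff i j p + divdiff i j q.
Proof.
move=> nij; apply: divdiff_unique => //.
rewrite scalerDr [X in X + _ = _]divdiffE [X in _ + X = _]divdiffE.
rewrite [X in _ = X - _](raddfD (tact i j)) [X in _ = _ - X](raddfD (act i j)) opprD.
by rewrite addrACA.
Qed.

Lemma divdiffZC i j c p : i != j -> divdiff i j (c%:MP_[N] *: p) = c%:MP_[N] *: divdiff i j p.
Proof.
move=> nij; apply: divdiff_unique => //.
rewrite scalerA mulrC -scalerA [X in _ *: X = _]divdiffE scalerBr.
by rewrite [X in _ = X - _]linearZ [X in _ = _ - X]sym_actZC.
Qed.

Lemma dunklD i p q : D i (p + q) = D i p + D i q.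
Proof.
rewrite /dunkl addrACA -scalerDr -big_split /=; congr (_ + _ *: _).
  by apply/ffunP=> E; rewrite !ffunE mderivD.
by apply: eq_bigr => j nji; rewrite divdiffD // eq_sym.
Qed.

Lemma dunklZC i c p : D i (c%:MP_[N] *: p) = c%:MP_[N] *: D i p.
Proof.
rewrite /dunkl scalerDr scalerA mulrC -scalerA; congr (_ + _ *: _).
  by apply/ffunP=> E; rewrite !ffunE mderiv_mulC.
by rewrite scaler_sumr; apply: eq_bigr => j nji; rewrite divdiffZC // eq_sym.
Qed.

Lemma cherednikD i p q : U i (p + q) = U i p + U i q.
Proof.
have actD : \sum_(j < N | (j < i)%N) act i j (p + q) =
    \sum_(j < N | (j < i)%N) act i j p + \sum_(j < N | (j < i)%N) act i j q.
  by rewrite -big_split; apply: eq_bigr => j _; apply: raddfD.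
rewrite /cherednik [X in D i X - _ = _]scalerDr dunklD actD.
by rewrite [X in _ - X = _]scalerDr opprD addrACA.
Qed.

Lemma cherednikZC i c p : U i (c%:MP_[N] *: p) = c%:MP_[N] *: U i p.
Proof.
have actZ : \sum_(j < N | (j < i)%N) act i j (c%:MP_[N] *: p) =
    c%:MP_[N] *: \sum_(j < N | (j < i)%N) act i j p.
  by rewrite scaler_sumr; apply: eq_bigr => j _; apply: sym_actZC.
have scaleC (f : {mpoly R[N]}) q : f *: (c%:MP_[N] *: q) = c%:MP_[N] *: (f *: q).
  by rewrite !scalerA mulrC.
by rewrite /cherednik scaleC dunklZC actZ [X in _ - X = _]scaleC [X in _ = X]scalerBr.
Qed.

End Cherednik.

(** * Compositions: ranks, sorting and the height *)

Lemma sorted_enum_set n (E : {set 'I_n}) : sorted (fun i j : 'I_n => i < j)%N (enum E).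
Proof.
apply: sorted_filter; first by move=> x y z; apply: ltn_trans.
by have := iota_ltn_sorted 0 n; rewrite -val_enum_ord sorted_map enumT.
Qed.

Lemma enum_set_eq n (E : {set 'I_n}) (t : seq 'I_n) :
  sorted (fun i j : 'I_n => i < j)%N t -> E =i t -> enum E = t.
Proof.
move=> st Et; apply: (@irr_sorted_eq _ (fun i j : 'I_n => i < j)%N) => //.
- by move=> x y z; apply: ltn_trans.
- by move=> x; apply: ltnn.
- exact: sorted_enum_set.
- by move=> x; rewrite mem_enum Et.
Qed.

Lemma card_ord_lt n l : (l <= n)%N -> #|[set i : 'I_n | (i < l)%N]| = l.
Proof.
move=> ln; rewrite -sum1dep_card -(big_ord_widen n (fun=> 1%N)) //.
by rewrite sum1_card card_ord.
Qed.

Section Compositions.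

Variable N : nat.

Implicit Types (a b : 'X_{1..N}) (i j l : 'I_N) (w : 'S_N).

(** The strict order whose ranks are given by r_a: by decreasing value, ties by
    position. *)
Definition precedes a i j : bool := (a j < a i)%N || (a i == a j) && (i < j)%N.

Lemma rank_card a i : rank a i = #|[set j | precedes a j i]|.
Proof.
by rewrite rankE; apply: eq_card => j; rewrite !inE /precedes andbC.
Qed.

Lemma rank_ltE a i j : (rank a i < rank a j)%N = precedes a i j.
Proof.
have lt_rank k l : precedes a k l -> (rank a k < rank a l)%N.
  move=> kl; rewrite !rank_card; apply: proper_card; apply/properP; split.
    by apply/subsetP=> h; rewrite !inE; move: kl; rewrite /precedes; lia.
  by exists k; rewrite !inE // /precedes; lia.
apply/idP/idP; last exact: lt_rank.
apply: contraTT; rewrite -leqNgt => nij.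
have [<-//|neq_ij] := eqVneq i j; apply/ltnW/lt_rank.
have {}neq_ij : (i != j :> nat) by [].
by move: nij; rewrite /precedes; lia.
Qed.

Lemma rank_permE a i : rank_perm a i = rank a i :> nat.
Proof. by rewrite permE. Qed.

Lemma mnm_seq a : a = [seq a l | l <- enum 'I_N] :> seq nat.
Proof. by rewrite -[in LHS](map_tnth_enum a). Qed.

Lemma mnm_perm a w : perm_eq (a#w) a.
Proof.
rewrite (mnm_seq (a#w)) (mnm_seq a) (eq_map (g := a \o w)) => [|l]; last by rewrite mnmE.
rewrite map_comp perm_map // uniq_perm ?enum_uniq ?(map_inj_uniq perm_inj) ?enum_uniq // => l.
by rewrite mem_enum -[l](permKV w) map_f ?mem_enum.
Qed.

Lemma perm_comp_sort a b : perm_eq a b -> comp_sort a = comp_sort b.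
Proof.
move=> ab; apply/mnmP=> l; rewrite !mnmE; congr nth.
apply/perm_sortP => //.
- by move=> x y; apply: leq_total.
- by move=> y x z xy yz; apply: leq_trans xy.
- by move=> x y; rewrite andbC; apply: anti_leq.
Qed.

Lemma comp_sort_perm a w : comp_sort (a#w) = comp_sort a.
Proof. exact/perm_comp_sort/mnm_perm. Qed.

Lemma comp_sort_rank a i : comp_sort a (rank_perm a i) = a i.
Proof.
(* a read in the order of the ranks is nonincreasing *)
pose b := a#(rank_perm a)^-1%g.
have sb : sorted geq b.
  rewrite mnm_seq sorted_map.
  have : sorted (fun l k : 'I_N => l < k)%N (enum 'I_N).
    by have := iota_ltn_sorted 0 N; rewrite -val_enum_ord sorted_map.
  apply: sub_sorted => l k lk; rewrite /= !mnmE.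
  have := rank_ltE a ((rank_perm a)^-1%g l) ((rank_perm a)^-1%g k).
  by rewrite -!rank_permE !permKV lk /precedes => /esym; lia.
have <- : comp_sort b = comp_sort a by apply: comp_sort_perm.
have -> : comp_sort b = b.
  apply/mnmP=> l; rewrite mnmE sorted_sort -?mnm_nth // => y x z xy yz; exact: leq_trans yz xy.
by rewrite mnmE permK.
Qed.

(** The swap moves two different values, so ties keep their relative order. *)
Lemma rank_perm_swap a (s : 'S_N) i j : s = tperm i j -> j = i.+1 :> nat -> a i != a j ->
  rank_perm (a#s) = (s * rank_perm a)%g.
Proof.
move=> -> ij aij; apply/permP=> l; apply/val_inj; rewrite permM /= !rank_permE !rank_card.
rewrite -[RHS](card_preimset _ (@perm_inj _ (tperm i j))); apply: eq_card => k.
rewrite !inE /precedes !mnmE.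
by case: tpermP => [->|->|/eqP + /eqP +]; case: tpermP => [->|->|/eqP + /eqP +];
  rewrite -?(inj_eq val_inj) /=; lia.
Qed.

Lemma rank_adjacent a i j : j = i.+1 :> nat -> a i = a j -> rank a j = (rank a i).+1.
Proof.
move=> ij aij; rewrite !rank_card.
rewrite (cardsD1 i) (_ : i \in _); last by rewrite inE /precedes; lia.
congr _.+1; apply: eq_card => k; rewrite !inE /precedes aij.
case: eqVneq => [->|ki]; first by rewrite -aij; lia.
have {}ki : (k != i :> nat) by [].
lia.
Qed.

Lemma partition_rank a : is_partition a -> rank_perm a = 1%g.
Proof.
move=> pa; apply/permP=> l; apply/val_inj; rewrite perm1 /= rank_permE rank_card.
have -> : [set k | precedes a k l] = [set k : 'I_N | (k < l)%N].
  apply/setP=> k; rewrite !inE /precedes.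
  by case: (ltngtP k l) => [kl|lk|/val_inj->]; [have := pa k l | have := pa l k |]; lia.
exact/card_ord_lt/ltnW/ltn_ord.
Qed.

Lemma partition_sort a : is_partition a -> comp_sort a = a.
Proof. by move=> pa; apply/mnmP=> i; rewrite -[RHS]comp_sort_rank partition_rank // perm1. Qed.

Lemma rearrange_sort a b : is_partition b -> comp_sort a = b -> a = b#(rank_perm a).
Proof. by move=> pb ab; apply/mnmP=> i; rewrite mnmE -ab comp_sort_rank. Qed.

Lemma partition_adjacent a :
  (forall i j, j = i.+1 :> nat -> (a j <= a i)%N) -> is_partition a.
Proof.
move=> Ha i j; have [n] := ubnP (j : nat); elim: n j => // n IHn j jn ij.
have [ij'|nij] := ltnP i j; last first.
  by have -> : j = i by apply: val_inj => /=; lia.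
have kN : (j.-1 < N)%N by have := ltn_ord j; lia.
apply: leq_trans (Ha (Ordinal kN) j _) (IHn (Ordinal kN) _ _) => /=; lia.
Qed.

(** A number in place of the dominance order.  Balancing two exponents lowers the
    sum of squares, which the factor N makes outweigh the linear term; exchanging
    two exponents keeps the squares, and the linear term, with weights decreasing
    from N - 1 to 0, rises when the larger one moves forward. *)
Definition height_at a l : nat := (N * a l ^ 2 + a l * (N.-1 - l))%N.

Definition height a : nat := \sum_(l < N) height_at a l.

Lemma height_two a b i j : i != j -> (forall l, l != i -> l != j -> a l = b l) ->
  (height a < height b)%N =
  (height_at a i + height_at a j < height_at b i + height_at b j)%N.
Proof.
move=> nij ab; rewrite /height (bigD1 i) // [X in (_ < X)%N](bigD1 i) //=.
rewrite (bigD1 j) 1?eq_sym // [X in (_ < _ + X)%N](bigD1 j) 1?eq_sym //=.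
rewrite !addnA [X in (_ + X < _)%N](eq_bigr (height_at b)) ?ltn_add2r // => l /andP[li lj].
by rewrite /height_at ab.
Qed.

(** The squares are unchanged, and the larger value moves to the larger weight. *)
Lemma height_swap a i j : (i < j)%N -> (a i < a j)%N -> (height a < height (a#tperm i j))%N.
Proof.
move=> ij aij; have nij : i != j by rewrite -(inj_eq val_inj) neq_ltn ij.
rewrite (height_two nij) => [|l li lj]; last by rewrite mnmE tpermD // eq_sym.
rewrite /height_at !mnmE tpermL tpermR; have := ltn_ord j; nia.
Qed.

(** Sorting by exchanges of neighbours only increases the height. *)
Lemma height_max a b : is_partition b -> comp_sort a = b -> a != b ->
  (height a < height b)%N.
Proof.
move=> pb ab nab.
(* a rearrangement of maximal height has no ascent, hence is b *)
have [w _ wmax] := arg_maxnP (fun w : 'S_N => height (b#w)) (i0 := 1%g) (P := xpredT) isT.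
have pw : is_partition (b#w).
  apply: partition_adjacent => i j ij; rewrite leqNgt; apply/negP => lt.
  have := wmax (tperm i j * w)%g isT; rewrite /= leqNgt => /negP[].
  rewrite mpermM; apply: height_swap => //; lia.
have bw : b#w = b by rewrite -[LHS]partition_sort // comp_sort_perm partition_sort.
have hmax c : comp_sort c = b -> (height c <= height b)%N.
  by move=> cb; rewrite (rearrange_sort pb cb) -{2}bw; apply: wmax.
rewrite ltn_neqAle hmax // andbT; apply: contra nab => /eqP hab; rewrite -ab.
apply/eqP/esym/partition_sort/partition_adjacent => i j ij; rewrite leqNgt; apply/negP => lt.
have := hmax (a#tperm i j); rewrite comp_sort_perm => /(_ ab); rewrite -hab leqNgt => /negP[].
apply: height_swap => //; lia.
Qed.

End Compositions.

(** * Triangularity of the Cherednik operators *)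

Section TwoVariables.

Variable N : nat.

Implicit Types (m b : 'X_{1..N}) (i j l : 'I_N).

Definition mset m i j x y : 'X_{1..N} :=
  [multinom if l == i then x else if l == j then y else m l | l < N].

Lemma mset_id m i j : mset m i j (m i) (m j) = m.
Proof. by apply/mnmP=> l; rewrite mnmE; case: eqP => [->|_]; [|case: eqP => [->|]]. Qed.

Lemma mset_swap m i j : mset m i j (m j) (m i) = m#tperm i j.
Proof.
by apply/mnmP=> l; rewrite !mnmE; case: tpermP => [->|->|/eqP/negPf-> /eqP/negPf->];
  rewrite ?eqxx //; case: eqP => // ->.
Qed.

Lemma msetX (R : comNzRingType) m i j x y : i != j ->
  'X_[mset m i j x y] = 'X_[mset m i j 0 0] * ('X_i ^+ x * 'X_j ^+ y) :> {mpoly R[N]}.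
Proof.
move=> nij; rewrite !mpolyXn -!mpolyXD; congr 'X_[_]; apply/mnmP=> l.
rewrite !(mnmE, mnmDE, mulmnE, mnm1E) [i == l]eq_sym [j == l]eq_sym.
have [->|_] := eqVneq l i; first by rewrite (negPf nij); lia.
by have [_|_] := eqVneq l j; lia.
Qed.

(** The inequality behind [height_between]: the outer exponents are a and
    a + s + t, the inner ones a + s and a + t, and w, w' are the weights. *)
Lemma square_gap (n a s t w w' : nat) : (0 < s)%N -> (0 < t)%N -> (w < n)%N ->
  (n * (a + s) ^ 2 + (a + s) * w + (n * (a + t) ^ 2 + (a + t) * w') <
   n * a ^ 2 + a * w + (n * (a + s + t) ^ 2 + (a + s + t) * w'))%N.
Proof.
move=> s0 t0 wn; have h1 : (s * w < s * n)%N by rewrite ltn_pmul2l.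
have h2 : (s * n <= s * n * t)%N by rewrite leq_pmulr.
nia.
Qed.

(** Moving two exponents towards each other loses 2 N times the product of the two
    gaps in the quadratic part, more than the linear part can gain. *)
Lemma height_between m i j x y : i != j -> (x + y = m i + m j)%N ->
  (minn (m i) (m j) < x < maxn (m i) (m j))%N ->
  (height (mset m i j x y) < height m)%N.
Proof.
move=> nij xy xlt; rewrite (height_two nij) => [|l li lj]; last first.
  by rewrite mnmE (negPf li) (negPf lj).
rewrite /height_at !mnmE eqxx eq_sym (negPf nij) eqxx.
have wN k : (k < N -> N.-1 - k < N)%N by lia.
have [wi wj] := (wN i (ltn_ord i), wN j (ltn_ord j)).
move: (N.-1 - i)%N (N.-1 - j)%N wi wj => w w' wi wj.
have [le_ij|lt_ji] := leqP (m i) (m j).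
  have -> : x = (m i + (x - m i))%N by lia.
  have -> : y = (m i + (y - m i))%N by lia.
  have -> : m j = (m i + (x - m i) + (y - m i))%N by lia.
  by apply: square_gap => //; lia.
rewrite addnC [X in (_ < X)%N]addnC.
have -> : x = (m j + (x - m j))%N by lia.
have -> : y = (m j + (y - m j))%N by lia.
have -> : m i = (m j + (y - m j) + (x - m j))%N by lia.
by apply: square_gap => //; lia.
Qed.

(** The quotient of x_i x^m - x_j x^(m swapped) by x_i - x_j, as a geometric sum. *)
Definition xdiffX (R : comNzRingType) i j m : {mpoly R[N]} :=
  if (m j <= m i)%N then \sum_(s < (m i - m j).+1) 'X_[mset m i j (m i - s) (m j + s)]
  else - \sum_(s < (m j - m i).-1) 'X_[mset m i j (m j - s.+1) (m i + s.+1)].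

Lemma xdiffXE (R : comNzRingType) i j m : i != j ->
  ('X_i - 'X_j) * xdiffX R i j m = 'X_i * 'X_[m] - 'X_j * msym (tperm i j) 'X_[m].
Proof.
move=> nij; have Em : 'X_[m] = 'X_[mset m i j 0 0] * ('X_i ^+ m i * 'X_j ^+ m j) :> {mpoly R[N]}.
  by rewrite -msetX // mset_id.
rewrite msymX tpermV -mset_swap msetX // Em /xdiffX.
set C := 'X_[mset m i j 0 0]; set x := 'X_i; set y := 'X_j.
move: (m i) (m j) => a b; case: leqP => [le_ba|lt_ab].
  (* both sides are divisible by (x y) to the smaller exponent *)
  transitivity (C * (x * y) ^+ b * (x ^+ (a - b).+1 - y ^+ (a - b).+1)).
    rewrite subrXX mulrCA; congr (_ * _); rewrite mulr_sumr; apply: eq_bigr => s _.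
    rewrite msetX // -/C -/x -/y -mulrA; congr (C * _).
    rewrite exprMn mulrACA -!exprD; congr (x ^+ _ * y ^+ _); have := ltn_ord s; lia.
  rewrite mulrBr -!mulrA !exprMn.
  have -> : x ^+ b * y ^+ b * x ^+ (a - b).+1 = x * (x ^+ a * y ^+ b).
    by rewrite mulrAC -exprD addnS subnKC // exprS mulrA.
  have -> : x ^+ b * y ^+ b * y ^+ (a - b).+1 = y * (x ^+ b * y ^+ a).
    by rewrite -mulrA -exprD addnS subnKC // exprS mulrCA.
  by rewrite !(mulrCA C).
transitivity (C * (x * y) ^+ a.+1 * (y ^+ (b - a).-1 - x ^+ (b - a).-1)).
  rewrite -[y ^+ _ - _]opprB subrXX !mulrN mulrCA; congr (- (_ * _)); rewrite mulr_sumr.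
  apply: eq_bigr => s _; rewrite msetX // -/C -/x -/y -mulrA; congr (C * _).
  rewrite exprMn mulrACA -!exprD; congr (x ^+ _ * y ^+ _); have := ltn_ord s; lia.
rewrite mulrBr -!mulrA !exprMn.
have -> : x ^+ a.+1 * y ^+ a.+1 * y ^+ (b - a).-1 = x * (x ^+ a * y ^+ b).
  by rewrite -mulrA -exprD exprS -mulrA; congr (_ * (_ * _ ^+ _)); lia.
have -> : x ^+ a.+1 * y ^+ a.+1 * x ^+ (b - a).-1 = y * (x ^+ b * y ^+ a).
  rewrite mulrAC -exprD [y ^+ _]exprS mulrCA; congr (_ * (_ ^+ _ * _)); lia.
by rewrite !(mulrCA C).
Qed.

(** All monomials of the quotient other than x^m and its swap are lower than x^m.
    After subtraction of the term of the last sum of the Cherednik operator, the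
    swap survives only where it is lower as well; so only the diagonal is seen. *)
Lemma mcoeff_xdiffX (R : comNzRingType) i j m b : i != j -> (height m <= height b)%N ->
  (xdiffX R i j m)@_b - (j < i)%:R * (m == b#tperm i j)%:R =
  (precedes b i j)%:R * (m == b)%:R.
Proof.
move=> nij hmb; have nji : j != i by rewrite eq_sym.
have neq_ij : i != j :> nat by [].
have swapE c c' : (c == c'#tperm i j) = (c#tperm i j == c').
  by apply/eqP/eqP => [->|<-]; rewrite -mpermM tperm2 mperm1.
have between x y : (x + y = m i + m j)%N -> (minn (m i) (m j) < x < maxn (m i) (m j))%N ->
    mset m i j x y == b = false.
  move=> xy xlt; apply/negP => /eqP mb.
  by have := height_between nij xy xlt; rewrite mb ltnNge hmb.
rewrite /xdiffX; have [le_ji|lt_ij] := leqP (m j) (m i); last first.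
  rewrite mcoeffN raddf_sum /= big1 => [|s _]; last first.
    by rewrite mcoeffX between //; have := ltn_ord s; lia.
  rewrite oppr0 sub0r; have [bm|_] := eqVneq m (b#_).
    (* here m is the swap of b, which is not higher than b only if i < j *)
    have bi : b i = m j by rewrite bm mnmE tpermR.
    have bj : b j = m i by rewrite bm mnmE tpermL.
    have -> : (j < i)%N = false.
      apply/negP => ji; move: hmb; rewrite leqNgt => /negP[].
      by rewrite bm tpermC; apply: height_swap; rewrite // ?bi ?bj.
    have [mb|_] := eqVneq m b; last by rewrite mulr0 mul0r oppr0.
    by rewrite mb in lt_ij; rewrite mb in bi; lia.
  have [mb|_] := eqVneq m b; last by rewrite !mulr0 oppr0.
  have -> : precedes b i j = false by rewrite /precedes -mb; lia.
  by rewrite mulr0 mul0r oppr0.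
rewrite raddf_sum /=; under eq_bigr do rewrite mcoeffX.
have [mb|nmb] := eqVneq m b.
  rewrite big_ord_recl /= subn0 addn0 mset_id mb eqxx big1 => [|s _]; last first.
    case: eqP => // /mnmP/(_ i); rewrite mnmE eqxx /bump; have := ltn_ord s; lia.
  rewrite addr0 mulr1 /precedes.
  have -> : (b == b#tperm i j) = (b i == b j).
    apply/eqP/eqP => [/mnmP/(_ i)|bij]; first by rewrite mnmE tpermL.
    by apply/mnmP=> l; rewrite mnmE; case: tpermP => [->|->|].
  rewrite mb in le_ji; case: (ltngtP (b j) (b i)) le_ji => //= _ _; rewrite ?mulr0 ?subr0 //.
  by rewrite mulr1; case: (ltngtP i j) neq_ij => // _ _; rewrite ?subrr ?subr0.
rewrite mulr0 big_ord_recr /= big1 ?add0r => [|s _]; last first.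
  have [s0|s0] := posnP s; first by rewrite s0 subn0 addn0 mset_id (negPf nmb).
  by rewrite between //; have := ltn_ord s; lia.
rewrite subKn // subnKC // mset_swap swapE.
have [mb|_] := eqVneq (m#_) b; last by rewrite mulr0 subr0.
have -> : (j < i)%N; last by rewrite mulr1 subrr.
have bi : b i = m j by rewrite -mb mnmE tpermL.
have bj : b j = m i by rewrite -mb mnmE tpermR.
have {}le_ji : (m j < m i)%N.
  rewrite ltn_neqAle le_ji andbT; apply: contra nmb => /eqP m_eq; rewrite -mb.
  by apply/eqP/mnmP => l; rewrite mnmE; case: tpermP => [->|->|].
have [//|ij|/val_inj ij] := ltngtP j i; last by rewrite ij eqxx in nij.
have := height_swap (a := b) ij; rewrite bi bj => /(_ le_ji).
by rewrite -mb -mpermM tperm2 mperm1 mb ltnNge hmb.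
Qed.

(** Divided differences enter the Cherednik operator only after multiplication by
    x_i; this is that composite on the coefficients of the phi_E. *)
Definition xdiff (R : comNzRingType) i j (f : {mpoly R[N]}) : {mpoly R[N]} :=
  \sum_(m <- msupp f) f@_m *: xdiffX R i j m.

Lemma xdiffE (R : comNzRingType) i j (f : {mpoly R[N]}) : i != j ->
  ('X_i - 'X_j) * xdiff i j f = 'X_i * f - 'X_j * msym (tperm i j) f.
Proof.
move=> nij; rewrite mulr_sumr {3 4}[f]mpolyE raddf_sum /= !mulr_sumr -sumrB.
by apply: eq_bigr => m _; rewrite msymZ -!scalerAr -scalerBr xdiffXE.
Qed.

Lemma mcoeff_xdiff (R : comNzRingType) i j (f : {mpoly R[N]}) b : i != j ->
  (forall m, m \in msupp f -> (height m <= height b)%N) ->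
  (xdiff i j f)@_b - (j < i)%:R * f@_(b#tperm i j) = (precedes b i j)%:R * f@_b.
Proof.
move=> nij hf.
have coefE c : f@_c = \sum_(m <- msupp f) f@_m * (m == c)%:R.
  by rewrite {1}[f]mpolyE raddf_sum; apply: eq_bigr => m _; rewrite /= mcoeffZ mcoeffX.
rewrite raddf_sum [in RHS]coefE [f@_(_#_)]coefE /= !mulr_sumr -sumrB.
apply: eq_big_seq => m mf; rewrite mcoeffZ mulrCA -mulrBr mcoeff_xdiffX ?hf //.
by rewrite mulrCA.
Qed.

End TwoVariables.

Section Triangularity.

Variables (N : nat) (R : comNzRingType) (kappa : R).

Implicit Types (p q : spoly N R) (i j l : 'I_N) (b : 'X_{1..N}).

Lemma divdiffX i j p : i != j ->
  divdiff i j ('X_i *: p) =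
  theta_act (tperm i j) [ffun E : {set 'I_N} => xdiff i j (p E)].
Proof.
move=> nij; apply: divdiff_unique => //.
rewrite sym_actZ msymXU tpermL /sym_act -!linearZ -linearB /=.
by congr (theta_act _ _); apply/ffunP=> E; rewrite !ffunE xdiffE.
Qed.

(** On a monomial that is highest in the support, the Cherednik operator acts
    through the Jucys-Murphy element of the index i for the order precedes. *)
Lemma x_coef_cherednik_top b p i :
  (forall m, x_coef m p != 0 -> (height m <= height b)%N) ->
  x_coef b (cherednik kappa i p) = (b i).+1%:R *: x_coef b p +
    kappa *: \sum_(j | precedes b i j) theta_act (tperm i j) (x_coef b p).
Proof.
move=> hp; rewrite /cherednik /dunkl raddfB raddfD /= !x_coefZ -addrA -scalerBr.
congr (_ + _ *: _).
  by apply/ffunP=> E; rewrite !ffunE mcoeff_deriv ['X_i * _]mulrC addmC mcoeffMX mulr_natl.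
rewrite !(raddf_sum (x_coef b)) /=.
have sum_lt (F : 'I_N -> ext N R) : \sum_(j < N | (j < i)%N) F j =
    \sum_(j < N | j != i) (j < i)%N%:R *: F j.
  rewrite big_mkcond [RHS]big_mkcond; apply: eq_bigr => j _.
  have [->|nji] := eqVneq j i; first by rewrite ltnn.
  by case: ltnP; rewrite ?scale1r ?scale0r.
have sum_pre (F : 'I_N -> ext N R) : \sum_(j < N | precedes b i j) F j =
    \sum_(j < N | j != i) (precedes b i j)%:R *: F j.
  rewrite big_mkcond [RHS]big_mkcond; apply: eq_bigr => j _.
  have [->|nji] := eqVneq j i; first by rewrite /precedes !ltnn andbF.
  by case: precedes; rewrite ?scale1r ?scale0r.
rewrite sum_lt sum_pre -sumrB /=; apply: eq_bigr => j nji.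
rewrite divdiffX 1?eq_sym // x_coef_sym_act x_coef_theta_act -!linearZ -linearB /=.
congr (theta_act _ _); apply/ffunP=> E; rewrite !ffunE mcoeff_xdiff // 1?eq_sym //.
move=> m mE; apply: hp; apply: contraTneq mE => /ffunP/(_ E).
by rewrite !ffunE => /eqP; rewrite mcoeff_eq0.
Qed.
End Triangularity.

(** * Contents of hook tableaux *)

Section Contents.

Variables (N m : nat).

Implicit Types (k : bool) (E F : {set 'I_N}) (i j l : 'I_N).

Local Notation hooks := (hook_sets N m).

Lemma gt_count_adjacent i j E : j = i.+1 :> nat ->
  gt_count i E = ((j \in E) + gt_count j E)%N.
Proof.
move=> ij; rewrite /gt_count (cardsD1 j) inE ij ltnSn andbT; congr (_ + _)%N.
apply: eq_card => l; rewrite !inE; have [->|lj] := eqVneq l j.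
  by rewrite ij ltnn andbF.
have {}lj : (l != j :> nat) by [].
by case: (l \in E) => //=; lia.
Qed.

Lemma gt_count_lt i E : i \in E -> (gt_count i E < #|E|)%N.
Proof.
move=> iE; apply/proper_card/properP; split; last by exists i; rewrite // inE ltnn andbF.
by apply/subsetP=> l; rewrite inE => /andP[].
Qed.

Lemma gt_count_gt0 i j E : (i < j)%N -> j \in E -> (0 < gt_count i E)%N.
Proof. by move=> ij jE; apply/card_gt0P; exists j; rewrite inE jE. Qed.

Lemma card_hook k E : E \in hooks k -> #|E| = if k then m.-1 else m.+1.
Proof. by case: k; rewrite inE => /andP[/eqP]. Qed.

Lemma hook_last k E i : E \in hooks k -> i.+1 = N -> (i \in E) = ~~ k.
Proof.
case: k; rewrite inE => /andP[_] /=.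
  by move=> /forall_inP HE iN; apply/negP => /HE; rewrite iN eqxx.
case/exists_inP => j jE /eqP jN iN; suff -> : i = j by [].
by apply: ord_inj; lia.
Qed.

Lemma content_neg k E i :
  (i \in E) = if k then (content k i E < 0)%R else (content k i E <= 0)%R.
Proof. by rewrite /content; case: k; case: (i \in E) => /=; lia. Qed.

(** Contents lie in an interval with N elements, so their differences stay in the
    range of denominators that genericity excludes. *)
Lemma content_bound k E F i j : E \in hooks k -> F \in hooks k ->
  (`|content k i E - content k j F| < N)%N.
Proof.
move=> /card_hook cE /card_hook cF.
have := cardsC E; have := cardsC F; rewrite card_ord.
have := @gt_count_lt i E; have := @gt_count_lt i (~: E).
have := @gt_count_lt j F; have := @gt_count_lt j (~: F).
rewrite !inE /content; case: k cE cF => cE cF; rewrite cE cF;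
case: (i \in E); case: (j \in F) => /=; lia.
Qed.

Lemma content_inj k E F :
  (forall i, content k i E = content k i F) -> E = F.
Proof.
by move=> EF; apply/setP=> i; rewrite !(content_neg k) EF.
Qed.

(** i and j lie in different arms of the hook, both off its corner: this is
    when exchanging two neighbours again gives a standard filling. *)
Definition separated i j E : bool :=
  (j.+1 != N) && ((i \in E) != (j \in E)).

(** For neighbours i < j: both lie in the row of the hook, where the corner,
    occupied by the last index, counts as part of the row and of the column
    whether or not it belongs to E. *)
Definition in_row i j E : bool :=
  (i \notin E) && ((j \notin E) || (j.+1 == N)).

Definition in_col i j E : bool :=
  (i \in E) && ((j \in E) || (j.+1 == N)).

Section Adjacent.

Variables (i j : 'I_N).
Hypothesis ij : j = i.+1 :> nat.

Let s := tperm i j.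

Lemma adjacent_trichotomy E : [|| separated i j E, in_row i j E | in_col i j E].
Proof.
by rewrite /separated /in_row /in_col; case: (i \in E); case: (j \in E); case: (j.+1 == N).
Qed.

Lemma content_row k E : E \in hooks k -> in_row i j E ->
  content k i E = content k j E + 1.
Proof.
move=> hE /andP[/negPf iE]; rewrite /content iE (gt_count_adjacent _ ij) inE.
have [jE|jE] /= := boolP (j \in E); last by case: k hE => _ _; lia.
move=> /eqP jN; have := hook_last hE jN; rewrite jE.
case: k hE => // _ _; rewrite /gt_count !(eq_card0 (A := [set _ in _ | _])) //;
by move=> l; rewrite !inE; have := ltn_ord l; lia.
Qed.

Lemma content_col k E : E \in hooks k -> in_col i j E ->
  content k i E = content k j E - 1.
Proof.
move=> hE /andP[iE]; rewrite /content iE (gt_count_adjacent _ ij).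
have [jE|jE] /= := boolP (j \in E); first by case: k hE => _ _; lia.
move=> /eqP jN; have := hook_last hE jN; rewrite (negPf jE).
case: k hE => // _ _; rewrite /gt_count !(eq_card0 (A := [set _ in _ | _])) //;
by move=> l; rewrite !inE; have := ltn_ord l; lia.
Qed.

(** The orientation of a separated pair for which exchanging i and j is a step
    of the recursion defining the vectors T. *)
Definition upward k E : bool := if k then (i \in E) && (j \notin E)
  else (i \notin E) && (j \in E).

(** The corner separates the two arms, hence the gap of at least 2; in particular
    1 + 1 / d is nonzero for this difference d. *)
Lemma content_upward k E : E \in hooks k -> j.+1 != N -> upward k E ->
  if k then (content k i E - content k j E <= - 2)%R
  else (2 <= content k i E - content k j E)%R.
Proof.
move=> hE jN; have n1 : (N.-1 < N)%N by have := ltn_ord i; lia.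
pose n : 'I_N := Ordinal n1.
have nN : n.+1 = N by rewrite /=; lia.
have jn : (j < n)%N by have := ltn_ord j; rewrite /=; lia.
have := hook_last hE nN; case: k hE => hE nE /andP[iE jE]; rewrite /content.
  by rewrite iE (negPf jE); have := @gt_count_gt0 j n (~: E) jn; rewrite inE nE => /(_ isT); lia.
by rewrite (negPf iE) jE; have := @gt_count_gt0 j n E jn nE; lia.
Qed.

Lemma imset_swapE l E : (l \in s @: E) = (s l \in E).
Proof. by rewrite -{1}[l](tpermK i j) (mem_imset _ _ perm_inj). Qed.

Lemma imset_swapC E : s @: (~: E) = ~: (s @: E).
Proof. by apply/setP=> l; rewrite !(imset_swapE, inE). Qed.

Lemma imset_swapK E : s @: (s @: E) = E.
Proof. by apply/setP=> l; rewrite !imset_swapE tpermK. Qed.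

Lemma gt_count_swap l E : l != i -> gt_count l (s @: E) = gt_count l E.
Proof.
move=> li; have {}li : (l != i :> nat) by [].
rewrite /gt_count -[RHS](card_imset _ (@perm_inj _ s)); apply: eq_card => x.
rewrite !(imset_swapE, inE); congr (_ && _).
by rewrite /s; case: tpermP => [->|->|//]; lia.
Qed.

Lemma content_swap k l E : (i \in E) != (j \in E) ->
  content k l (s @: E) = content k (s l) E.
Proof.
move=> sep; have nji : j != i by rewrite -(inj_eq val_inj) /=; lia.
have gi (A : {set 'I_N}) : gt_count i (s @: A) = ((i \in A) + gt_count j A)%N.
  by rewrite (gt_count_adjacent _ ij) imset_swapE tpermR gt_count_swap.
have gj (A : {set 'I_N}) : gt_count j (s @: A) = gt_count j A by apply: gt_count_swap.
have gi' (A : {set 'I_N}) : gt_count i A = ((j \in A) + gt_count j A)%N := gt_count_adjacent A ij.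
rewrite /content imset_swapE -imset_swapC /s.
case: tpermP => [->|->|/eqP li /eqP lj]; last by rewrite !gt_count_swap.
  rewrite !gi inE; move: sep.
  by case: (i \in E); case: (j \in E).
rewrite !gj !gi' inE; move: sep.
by case: (i \in E); case: (j \in E).
Qed.

Lemma hook_swap k E : E \in hooks k -> j.+1 != N -> s @: E \in hooks k.
Proof.
move=> hE jN; have [jl il] := (ltn_ord j, ltn_ord i).
have sN l : l.+1 = N -> s l = l.
  by move=> lN; rewrite tpermD // -(inj_eq val_inj) /= neq_ltn; lia.
have nlast := hook_last hE; move: hE nlast.
case: k; rewrite !inE (card_imset _ perm_inj) => /andP[-> _] nlast /=.
  apply/forall_inP => l; rewrite imset_swapE => lE; apply/negP => /eqP lN.
  by move: lE; rewrite (sN _ lN) nlast.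
have nN : (N.-1 < N)%N by lia.
have lN : (Ordinal nN).+1 = N by rewrite /=; lia.
by apply/exists_inP; exists (Ordinal nN); rewrite ?lN // imset_swapE sN ?nlast.
Qed.

(** The signs of the contents tell in which arm an entry lies, so a set with the
    exchanged contents can only be the image of E; if i and j are in one arm it
    is E itself, although their contents differ by 1. *)
Lemma content_swap_separated k E F : E \in hooks k -> F \in hooks k ->
  (forall l, content k l F = content k (s l) E) -> separated i j E.
Proof.
move=> hE hF FE; rewrite /separated; have memF l : (l \in F) = (s l \in E).
  by rewrite !(content_neg k) FE.
have neq_c : (i \in E) = (j \in E) -> False.
  move=> ijE; have FEs : F = E.
    by apply/setP=> l; rewrite memF /s; case: tpermP => [->|->|].
  have := FE i; rewrite tpermL FEs; have := content_row hE; have := content_col hE.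
  rewrite /in_row /in_col ijE; case: (j \in E) => /= [/(_ isT)+ _|_ /(_ isT)+]; lia.
apply/andP; split; last by apply/negP => /eqP/neq_c.
apply/negP => /eqP jN; apply: neq_c.
by rewrite (hook_last hE jN) -(hook_last hF jN) memF tpermR.
Qed.

End Adjacent.
End Contents.

(** * The span of the vectors T *)

(** The last index comes last in the enumeration, which exhibits the corner cell
    and the last factor of an increasing product. *)
Lemma enum_last n (o : 'I_n) (E : {set 'I_n}) : o.+1 = n -> o \in E ->
  enum E = rcons (enum (E :\ o)) o.
Proof.
move=> on oE; have lt_last l : l != o -> (l < o)%N.
  have neqE (u v : 'I_n) : (u != v) = (u != v :> nat) by [].
  by rewrite neqE; have := ltn_ord l; lia.
apply: enum_set_eq => [|l]; last first.
  by rewrite mem_rcons inE mem_enum !inE; case: eqP => [->|].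
have ltT : transitive (fun i j : 'I_n => i < j)%N by move=> x y z; apply: ltn_trans.
rewrite (sorted_pairwise ltT) pairwise_rcons -(sorted_pairwise ltT) sorted_enum_set andbT.
by apply/allP => l; rewrite mem_enum !inE => /andP[/lt_last].
Qed.

Section HookGenerators.

Variables (N m : nat) (R : realFieldType).

Variable k : bool.
Variable oN : 'I_N.
Hypothesis hoN : oN.+1 = N.

Implicit Types (E F H : {set 'I_N}) (i j l : 'I_N) (v : ext N R) (w : 'S_N).

Local Notation hooks := (hook_sets N m k).

(** For k = 0 the products of the differences theta_i - theta_N, for k = 1 the
    multiples of the invariant sum of all theta_i; [oN] is the last index.
    Treating it as a generator costs nothing: for k = 0 its factor is 0, for
    k = 1 it is minus the sum of the others modulo the annihilator of the head. *)
Definition hgen_factor i : ext N R := if k then theta i else theta i - theta oN.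

Definition hgen_head : ext N R := if k then \sum_i theta i else 1.

Definition hgen H : ext N R := hgen_head * \prod_(i <- enum H) hgen_factor i.

Lemma hgen_factor_anticommuting : anticommuting hgen_factor.
Proof.
rewrite /hgen_factor; case: k; first exact: theta_anticommuting.
have ac i j : (theta i - theta oN) * (theta j - theta oN) =
    - ((theta j - theta oN) * (theta i - theta oN)) :> ext N R.
  rewrite !mulrBl !mulrBr !theta_sqr !subr0 (theta_anticomm _ i j).
  rewrite (theta_anticomm _ i oN) (theta_anticomm _ oN j).
  by rewrite !opprB !opprK -addrA addrC addrA.
split=> // i; rewrite mulrBl !mulrBr !theta_sqr subr0 sub0r (theta_anticomm _ i oN).
by rewrite opprK subrr.
Qed.

Lemma hgen_head_factor i : hgen_head * hgen_factor i = (-1) ^+ k * (hgen_factor i * hgen_head).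
Proof.
rewrite /hgen_head /hgen_factor; case: k; last by rewrite mul1r mulr1 expr0 mul1r.
rewrite expr1 mulN1r mulr_suml mulr_sumr -sumrN.
by apply: eq_bigr => l _; rewrite theta_anticomm.
Qed.

(** Odd elements square to zero; obtained from anticommutation since 2 is
    invertible. *)
Lemma hgen_head_sqr : k -> hgen_head * hgen_head = 0.
Proof.
rewrite /hgen_head; case: k => // _.
have E2 (x : ext N R) : x = - x -> x = 0.
  move=> xx; apply: (scalerI (a := 2%:R : R)); first by rewrite pnatr_eq0.
  by rewrite scaler0 scaler_nat mulr2n {1}xx addNr.
apply: E2; rewrite {1}mulr_suml mulr_suml -sumrN.
have -> : \sum_i theta i * \sum_i theta i = \sum_i \sum_j theta i * theta j :> ext N R.
  by apply: eq_bigr => i _; rewrite mulr_sumr.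
rewrite exchange_big /=; apply: eq_bigr => i _; rewrite mulr_sumr -sumrN.
by apply: eq_bigr => l _; rewrite theta_anticomm.
Qed.

Definition hspan (P : pred {set 'I_N}) v : Prop :=
  exists b : {set 'I_N} -> R, v = \sum_(H | P H) b H *: hgen H.

Definition hdeg (r : nat) : pred {set 'I_N} := fun H => (#|H| == r) && (oN \notin H).

Section Span.

Variable P : pred {set 'I_N}.

Lemma hspan0 : hspan P 0.
Proof. by exists (fun=> 0); rewrite big1 // => H _; rewrite scale0r. Qed.

Lemma hspanD u v : hspan P u -> hspan P v -> hspan P (u + v).
Proof.
move=> [b ->] [c ->]; exists (fun H : {set 'I_N} => b H + c H); rewrite -big_split.
by apply: eq_bigr => H _; rewrite scalerDl.
Qed.

Lemma hspanZ a v : hspan P v -> hspan P (a *: v).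
Proof.
move=> [b ->]; exists (fun H : {set 'I_N} => a * b H); rewrite scaler_sumr.
by apply: eq_bigr => H _; rewrite scalerA.
Qed.

Lemma hspanN v : hspan P v -> hspan P (- v).
Proof. by rewrite -scaleN1r; apply: hspanZ. Qed.

Lemma hspan_sum (I : Type) (s : seq I) (Q : pred I) (f : I -> ext N R) :
  (forall x, Q x -> hspan P (f x)) -> hspan P (\sum_(x <- s | Q x) f x).
Proof. by move=> fP; apply: big_ind; [exact: hspan0 | exact: hspanD |]. Qed.

Lemma hspan_sign (e : nat) v : hspan P v -> hspan P ((-1) ^+ e * v).
Proof. by move=> Hv; rewrite -signr_odd mulr_sign; case: odd => //; apply: hspanN. Qed.

Lemma hspan_gen H : P H -> hspan P (hgen H).
Proof.
move=> PH; exists (fun F : {set 'I_N} => (F == H)%:R).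
rewrite (bigD1 H) //= eqxx scale1r big1 ?addr0 //.
by move=> F /andP[_ /negPf->]; rewrite scale0r.
Qed.

Lemma hspan_linear (f : {linear ext N R -> ext N R}) (Q : pred {set 'I_N}) v :
  (forall H, Q H -> hspan P (f (hgen H))) -> hspan Q v -> hspan P (f v).
Proof.
move=> fQ [b ->]; rewrite linear_sum; apply: hspan_sum => H QH.
by rewrite linearZ; apply: hspanZ; apply: fQ.
Qed.

End Span.

Lemma hgen_perm (s : seq 'I_N) : uniq s -> exists e : nat,
  hgen_head * \prod_(i <- s) hgen_factor i = (-1) ^+ e * hgen [set i in s].
Proof.
move=> us; have ps : perm_eq s (enum [set i in s]).
  by apply: uniq_perm; rewrite ?enum_uniq // => i; rewrite mem_enum inE.
have [e He] := anticomm_perm ps; exists e.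
by rewrite (He _ _ hgen_factor_anticommuting) mulrA (commr_sign hgen_head) -mulrA.
Qed.

Lemma hspan_mul_off r v i : i != oN -> hspan (hdeg r) v -> hspan (hdeg r.+1) (v * hgen_factor i).
Proof.
move=> nN [b ->]; rewrite mulr_suml; apply: hspan_sum => H /andP[/eqP cH nH].
rewrite -scalerAl; apply: hspanZ; rewrite /hgen -mulrA -big_rcons /=.
have [iH|niH] := boolP (i \in H).
  rewrite (anticomm_nuniq hgen_factor_anticommuting) ?mulr0; first exact: hspan0.
  by rewrite rcons_uniq mem_enum iH.
have us : uniq (rcons (enum H) i) by rewrite rcons_uniq mem_enum niH enum_uniq.
have [e ->] := hgen_perm us; apply: hspan_sign.
apply: hspan_gen; rewrite /hdeg cardsE (card_uniqP us) size_rcons -cardE cH eqxx.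
by rewrite inE mem_rcons inE mem_enum negb_or nH andbT eq_sym.
Qed.

(** For the factor of the last index with k = 1: theta_N is the head minus the
    other theta_l, and the head squares to zero. *)
Lemma hspan_mul r v i : hspan (hdeg r) v -> hspan (hdeg r.+1) (v * hgen_factor i).
Proof.
have [->|nN] := eqVneq i oN; last exact: hspan_mul_off.
move=> Hv; case: (boolP k) => [kT|/negPf k0]; last first.
  by rewrite /hgen_factor k0 subrr mulr0; apply: hspan0.
have factorE l : hgen_factor l = theta l by rewrite /hgen_factor kT.
have -> : v * hgen_factor oN = v * hgen_head - \sum_(l | l != oN) v * hgen_factor l.
  rewrite /hgen_head kT (bigD1 oN) //= mulrDr factorE -mulr_sumr.
  under [in X in _ - X]eq_bigr do rewrite factorE.
  by rewrite addrK.
have -> : v * hgen_head = 0.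
  case: Hv => b ->; rewrite mulr_suml big1 // => H _; rewrite -scalerAl /hgen.
  rewrite -mulrA.
  have : forall i, hgen_head * hgen_factor i = - (hgen_factor i * hgen_head).
    by move=> l; rewrite hgen_head_factor kT expr1 mulN1r.
  move/(anticomm_prod (enum H)) => hd.
  have -> : \prod_(i <- enum H) hgen_factor i * hgen_head =
    (-1) ^+ size (enum H) * (hgen_head * \prod_(i <- enum H) hgen_factor i).
    by rewrite hd mulrA -expr2 sqrr_sign mul1r.
  by rewrite mulrA (commr_sign hgen_head) -mulrA [hgen_head * (_ * _)]mulrA hgen_head_sqr // mul0r mulr0 scaler0.
rewrite sub0r; apply/hspanN/hspan_sum => l lN; exact: hspan_mul_off.
Qed.

Lemma theta_act_hgen_head w : theta_act w hgen_head = hgen_head.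
Proof.
rewrite /hgen_head; case: k; last first.
  by have := @theta_act_prod N R w [::]; rewrite !big_nil.
rewrite linear_sum [RHS](reindex_inj (@perm_inj _ w)).
by apply: eq_bigr => i _; rewrite /= theta_act_theta.
Qed.

Lemma theta_act_hgen w H :
  theta_act w (hgen H) = hgen_head * \prod_(i <- enum H) theta_act w (hgen_factor i).
Proof.
rewrite theta_actM theta_act_hgen_head; congr (_ * _).
elim: (enum H) => [|i s IHs]; last by rewrite !big_cons theta_actM IHs.
by rewrite !big_nil; have := @theta_act_prod N R w [::]; rewrite !big_nil.
Qed.

Lemma theta_act_hgen_factor w i : theta_act w (hgen_factor i) =
  hgen_factor (w i) - (if k then 0 else hgen_factor (w oN)).
Proof.
rewrite /hgen_factor; case: k; first by rewrite subr0 theta_act_theta.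
by rewrite linearB /= !theta_act_theta opprB addrA subrK.
Qed.

(** The image of a product is the head times a product of combinations of
    factors, and the span is closed under multiplication by each factor. *)
Lemma hspan_theta_act w r v : hspan (hdeg r) v -> hspan (hdeg r) (theta_act w v).
Proof.
have gen H : hdeg r H -> hspan (hdeg r) (theta_act w (hgen H)).
  move=> /andP[/eqP <- _]; rewrite theta_act_hgen cardE.
  elim/last_ind: (enum H) => [|s i IHs].
    rewrite big_nil; have -> : hgen_head * 1 = hgen set0 by rewrite /hgen enum_set0 big_nil.
    by apply: hspan_gen; rewrite /hdeg cards0 inE.
  rewrite big_rcons mulrA size_rcons theta_act_hgen_factor mulrBr /=; apply: hspanD.
    exact: hspan_mul.
  apply: hspanN; case: (k); last exact: hspan_mul.
  by rewrite mulr0; apply: hspan0.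
exact: (hspan_linear (f := theta_act w) gen).
Qed.

Lemma sign_scale (e : nat) v : (-1) ^+ e * v = (-1) ^+ e *: v.
Proof. by rewrite -signr_odd mulr_sign -[in RHS]signr_odd scaler_sign. Qed.

Definition hook_deg : nat := if k then m.-1 else m.

Lemma hook_arm E : E \in hooks -> hdeg hook_deg (E :\ oN).
Proof.
move=> hE; rewrite /hdeg /hook_deg !inE eqxx /= andbT.
have := card_hook hE; rewrite (cardsD1 oN) (hook_last hE hoN).
by case: k => /= /eqP; rewrite ?add0n ?add1n ?eqSS.
Qed.

Lemma arm_hook H : hdeg hook_deg H -> exists2 E, E \in hooks & H = E :\ oN.
Proof.
case/andP=> /eqP cH nH; exists (if k then H else oN |: H); last first.
  apply/setP=> l; case: k; rewrite !inE; case: eqP => [->|] //=; exact/negbTE.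
move: cH; rewrite /hook_deg /hook_sets; case: k => cH; rewrite inE.
  rewrite cH eqxx; apply/forall_inP => l lH; apply: contraNneq nH => lN.
  by have -> : oN = l by apply: ord_inj; lia.
rewrite cardsU1 nH cH eqxx /=; apply/exists_inP; exists oN; last exact/eqP.
by rewrite !inE eqxx.
Qed.

(** The number of steps of the recursion for T leading to H, up to a constant. *)
Definition level H : nat := (\sum_(l in H) if k then l : nat else N - l)%N.

Definition low n : pred {set 'I_N} := fun H => hdeg hook_deg H && (level H < n)%N.

Lemma hspan_low n n' v : (n <= n')%N -> hspan (low n) v -> hspan (low n') v.
Proof.
move=> nn'; apply: (hspan_linear (f := idfun)) => H /andP[dH lH]; apply: hspan_gen.
by rewrite /low dH (leq_trans lH).
Qed.

Section Step.

Variables (i j : 'I_N).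
Hypotheses (ij : j = i.+1 :> nat) (jN : j.+1 != N).

Let s := tperm i j.

Let s_last : s oN = oN.
Proof.
have [jl il] := (ltn_ord j, ltn_ord i).
by rewrite tpermD // -(inj_eq val_inj) /= neq_ltn; lia.
Qed.

Lemma hdeg_swap r H : hdeg r (s @: H) = hdeg r H.
Proof. by rewrite /hdeg (card_imset _ perm_inj) imset_swapE -/s s_last. Qed.

(** A neighbouring transposition changes the level by at most 1, and raises it
    exactly for the steps of the recursion. *)
Lemma level_swap H :
  (level (s @: H) + ((if k then j else i) \in H) =
   level H + ((if k then i else j) \in H))%N.
Proof.
have memE (A : {set 'I_N}) x : (x \in A : nat) = (\sum_(l in A) (l == x))%N.
  have [xA|nxA] := boolP (x \in A).
    by rewrite (bigD1 x) //= eqxx big1 // => l /andP[_ /negPf->].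
  by rewrite big1 // => l lA; case: eqP nxA => // <-; rewrite lA.
rewrite /level big_imset /=; last by move=> x y _ _; apply: perm_inj.
rewrite !memE -!big_split; apply: eq_bigr => l _ /=.
have [jl il] := (ltn_ord j, ltn_ord i).
have nij : (i == j) = false by apply/eqP => /(congr1 val) /=; lia.
have nji : (j == i) = false by rewrite eq_sym.
rewrite /s; case: tpermP => [->|->|/eqP li /eqP lj].
- by case: k; rewrite ?eqxx ?nij ?nji; lia.
- by case: k; rewrite ?eqxx ?nij ?nji; lia.
by case: k; rewrite (negPf li) (negPf lj).
Qed.

(** Transpositions fixing the last index fix the head and permute the factors. *)
Lemma hgen_swap H : exists e : nat, theta_act s (hgen H) = (-1) ^+ e *: hgen (s @: H).
Proof.
have us : uniq [seq s l | l <- enum H] by rewrite (map_inj_uniq perm_inj) enum_uniq.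
have [e He] := hgen_perm us; exists e; rewrite -sign_scale theta_act_hgen.
have -> : s @: H = [set l in [seq s l | l <- enum H]].
  apply/setP=> l; rewrite inE imset_swapE -/s; apply/idP/mapP => [lH|[x + ->]].
    by exists (s l); rewrite ?mem_enum // /s tpermK.
  by rewrite mem_enum /s tpermK.
rewrite -He big_map; congr (_ * _); apply: eq_bigr => l _.
rewrite theta_act_hgen_factor s_last /hgen_factor.
by case: k; rewrite ?subrr subr0.
Qed.

Lemma hspan_low_swap n v : hspan (low n) v -> hspan (low n.+1) (theta_act s v).
Proof.
have gen H : low n H -> hspan (low n.+1) (theta_act s (hgen H)).
  move=> /andP[dH lH]; have [e ->] := hgen_swap H; apply/hspanZ/hspan_gen.
  rewrite /low hdeg_swap dH ltnS; apply: leq_trans (leq_addr ((if k then j else i) \in H) _) _.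
  by rewrite level_swap (leq_trans _ lH) // -addn1 leq_add2l leq_b1.
exact: (hspan_linear (f := theta_act s) gen).
Qed.

End Step.

(** Used to recognize the set where the recursion starts as the only one without
    a descent. *)
Lemma down_closedE (D : {set 'I_N}) :
  (forall i j, j = i.+1 :> nat -> j \in D -> i \in D) -> D = [set i : 'I_N | (i < #|D|)%N].
Proof.
move=> HD; have down n i j : j = (i + n)%N :> nat -> j \in D -> i \in D.
  elim: n j => [|n IHn] j jE jD.
    by have -> : i = j by apply: val_inj; rewrite /= jE addn0.
  have kN : (i + n < N)%N by have := ltn_ord j; lia.
  by apply: (IHn (Ordinal kN)) => //; apply: HD jD; rewrite /= jE addnS.
apply/eqP; rewrite eqEcard card_ord_lt ?leqnn ?andbT; last first.
  by rewrite -[X in (_ <= X)%N]card_ord max_card.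
apply/subsetP=> i iD; rewrite inE -[X in (X <= _)%N](card_ord_lt (ltn_ord i)).
apply/subset_leq_card/subsetP=> l; rewrite inE => li.
by apply: (down (i - l)%N) iD; rewrite subnKC //; lia.
Qed.

Section LowestVector.

Implicit Types (s : seq 'I_N).

(** For a sorted word: the contraction of its monomial with the linear form equal
    to 1 on every theta. *)
Let del s : ext N R := \sum_(i <- s) (-1) ^+ count (fun l : 'I_N => i < l)%N s *
  \prod_(l <- s | l != i) theta l.

Let del_cons i s : sorted (fun i j : 'I_N => i < j)%N (i :: s) ->
  del (i :: s) = (-1) ^+ size s * \prod_(l <- s) theta l + theta i * del s.
Proof.
move=> sis; have lti : all (fun j : 'I_N => i < j)%N s.
  by apply: order_path_min sis => x y z; apply: ltn_trans.
rewrite /del big_cons /= ltnn add0n big_cons eqxx; congr (_ * _ + _).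
- by congr (_ ^+ _); apply/eqP; rewrite -all_count.
- rewrite big_seq_cond [RHS]big_seq; apply: eq_bigl => l.
  by case: eqVneq => [->|]; rewrite ?andbT // andbF; apply/esym/negP => /(allP lti); rewrite ltnn.
rewrite mulr_sumr big_seq [RHS]big_seq; apply: eq_bigr => j js.
have ij := allP lti j js.
rewrite ltnNge (ltnW ij) add0n big_cons -(inj_eq val_inj) /= neq_ltn ij.
by rewrite !mulrA (commr_sign (theta i)).
Qed.

Let z_prod s z :
  theta z * \prod_(i <- s) (theta i - theta z) = (-1) ^+ size s * (\prod_(i <- s) theta i * theta z)
    :> ext N R.
Proof.
have -> : theta z * \prod_(i <- s) (theta i - theta z) = theta z * \prod_(i <- s) theta i :> ext N R.
  elim: s => [|i s IHs]; first by rewrite !big_nil.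
  rewrite !big_cons mulrA mulrBr theta_sqr subr0 theta_anticomm mulNr -mulrA IHs.
  by rewrite [RHS]mulrA [theta z * theta i]theta_anticomm mulNr mulrA.
by apply: anticomm_prod => i; apply: theta_anticomm.
Qed.

Let del_rcons s z : sorted (fun i j : 'I_N => i < j)%N (rcons s z) ->
  del (rcons s z) = \prod_(i <- s) (theta i - theta z).
Proof.
elim: s => [_|i s IHs sis].
  rewrite /del /= big_cons big_nil addr0 /= ltnn expr0 mul1r big_nil.
  by rewrite big_cons eqxx big_nil.
rewrite rcons_cons del_cons // IHs ?(path_sorted sis) // size_rcons.
rewrite big_cons mulrBl z_prod addrC exprS mulN1r mulNr; congr (_ - _ * _).
by rewrite -cats1 big_cat big_cons big_nil /= mulr1.
Qed.

(** Expanding the product, the factor theta_N can be chosen at most once; moved to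
    the end it contributes the sign of the deleted index. *)
Lemma lowest_column E : oN \in E ->
  \sum_(j in E) (-1) ^+ gt_count j E *: phi (E :\ j) =
  \prod_(i <- enum (E :\ oN)) (theta i - theta oN) :> ext N R.
Proof.
move=> nE; rewrite -del_rcons -(enum_last hoN nE) ?sorted_enum_set // /del -big_enum; apply: eq_bigr => j _.
rewrite sign_scale; congr ((-1) ^+ _ *: _).
  rewrite /gt_count cardE -size_filter; congr size; apply: enum_set_eq.
    by apply: sorted_filter (sorted_enum_set E) => x y z; apply: ltn_trans.
  by move=> l; rewrite mem_filter mem_enum inE andbC.
rewrite /phi -[RHS]big_filter; congr bigop.body; apply: enum_set_eq.
  by apply: sorted_filter (sorted_enum_set E) => x y z; apply: ltn_trans.
by move=> l; rewrite mem_filter mem_enum !inE.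
Qed.

End LowestVector.

Lemma lowest_row (E : {set 'I_N}) (n : nat) : E = [set i : 'I_N | (i < n)%N] ->
  \sum_(j < N | (n <= j)%N) phi (j |: E) = \prod_(i <- enum E) theta i * \sum_j theta j
    :> ext N R.
Proof.
move=> defE; rewrite mulr_sumr [RHS](bigID (fun j : 'I_N => n <= j)%N) /=.
rewrite [X in _ = _ + X]big1 ?addr0 => [|j]; last first.
  rewrite -ltnNge => jn.
  have := @anticomm_nuniq _ _ _ (rcons (enum E) j) (@theta_anticommuting N R).
  rewrite rcons_uniq mem_enum defE inE jn big_rcons /= => -> //.
apply: eq_bigr => j nj; rewrite -big_rcons; congr bigop.body; apply: enum_set_eq.
  have ltT : transitive (fun i j : 'I_N => i < j)%N by move=> x y z; apply: ltn_trans.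
  rewrite (sorted_pairwise ltT) pairwise_rcons -(sorted_pairwise ltT) sorted_enum_set andbT.
  by apply/allP => l; rewrite mem_enum defE inE => /leq_trans; apply.
by move=> l; rewrite mem_rcons !inE mem_enum.
Qed.

Variable T : {set 'I_N} -> ext N R.
Hypothesis hm : (1 <= m <= N.-1)%N.
Hypothesis hT : hook_vectors m k T.

Definition first_hook : {set 'I_N} :=
  if k then [set i : 'I_N | (i.+1 <= m.-1)%N] else [set i : 'I_N | (N - m <= i.+1)%N].

Lemma T_first : exists e : nat, T first_hook = (-1) ^+ e *: hgen (first_hook :\ oN).
Proof.
case: hT => _ _ T1 _; rewrite /first_hook /hgen /hgen_head /hgen_factor.
move: T1; case: k => /= ->; last first.
  by exists 0%N; rewrite expr0 scale1r mul1r lowest_column // inE; lia.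
set E := [set i : 'I_N | (i < m.-1)%N]; exists (size (enum E)).
have -> : E :\ oN = E.
  by apply/setP=> l; rewrite !inE; case: eqP => // ->; lia.
rewrite -sign_scale.
have th i : (\sum_j theta j) * theta i = - (theta i * \sum_j theta j) :> ext N R.
  rewrite mulr_suml mulr_sumr -sumrN; apply: eq_bigr => j _; exact: theta_anticomm.
rewrite (anticomm_prod (enum E) th) mulrA -expr2 sqrr_sign mul1r.
rewrite -(@lowest_row E m.-1) //; apply: eq_bigl => j; lia.
Qed.

Lemma hook_descent E : E \in hooks -> E != first_hook ->
  exists i j, [/\ j = i.+1 :> nat, j.+1 != N & upward i j k (tperm i j @: E)].
Proof.
move=> hE nE.
have [] := boolP [exists i : 'I_N, exists j : 'I_N, (j == i.+1 :> nat) &&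
    (if k then (i \notin E) && (j \in E) else (i \in E) && (j \notin E))].
  case/existsP=> i /existsP[j /andP[/eqP ij up]]; exists i, j; split=> //.
    apply/eqP => jN; move: up; rewrite (hook_last hE jN).
    by case: k; rewrite /= ?andbF.
  by rewrite /upward !imset_swapE // tpermL tpermR andbC; move: up; case: k => //; rewrite andbC.
rewrite negb_exists => /forallP Hn.
have {}Hn i j : j = i.+1 :> nat ->
    if k then (j \in E -> i \in E) else (i \in E -> j \in E).
  move=> ij; have := Hn i; rewrite negb_exists => /forallP/(_ j); rewrite ij eqxx /=.
  by case: k; case: (i \in E); case: (j \in E).
case/eqP: nE; rewrite /first_hook; have := card_hook hE; move: Hn; case: k => Hn cE.
  rewrite [LHS]down_closedE ?cE // => i j /Hn; exact.
rewrite -[LHS]setCK (@down_closedE (~: E)); last first.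
  by move=> i j /Hn ij; rewrite !inE; apply/contra/ij.
have := cardsC E; rewrite cE card_ord => cC; apply/setP=> l; rewrite !inE.
move: (ltn_ord l); lia.
Qed.

(** By induction along the recursion: the transposition carries the leading product
    to the next one up to sign, and everything else stays on lower levels. *)
Lemma T_expand E : E \in hooks -> exists2 a : R, a != 0 &
  hspan (low (level (E :\ oN))) (T E - a *: hgen (E :\ oN)).
Proof.
have [n] := ubnP (level (E :\ oN)); elim: n E => // n IHn E; rewrite ltnS => lE hE.
have [->|nE] := eqVneq E first_hook.
  have [e ->] := T_first; exists ((-1) ^+ e); first by rewrite signr_eq0.
  by rewrite subrr; apply: hspan0.
have [i [j [ij jN up]]] := hook_descent hE nE.
set s := tperm i j in up *; pose F := s @: E.
have hF : F \in hooks by apply: hook_swap.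
have EF : E = s @: F by rewrite /F imset_swapK.
have [jl il] := (ltn_ord j, ltn_ord i).
have nio : i != oN by apply/eqP => /(congr1 val) /=; lia.
have njo : j != oN by apply/eqP => /(congr1 val) /=; lia.
have EFo : E :\ oN = s @: (F :\ oN).
  apply/setP=> l; rewrite imset_swapE // !inE /F imset_swapE // tpermK.
  by rewrite -{2}[oN](tpermD nio njo) (inj_eq perm_inj).
have lF : level (E :\ oN) = (level (F :\ oN)).+1.
  have := level_swap ij jN (F :\ oN); rewrite -/s -EFo !inE.
  by move: up; rewrite -/F /upward; case: (k) => /andP[]; rewrite nio njo /=;
    [move=> -> /negPf -> | move=> /negPf -> ->]; rewrite addn0 addn1.
have [|a a0 Ha] := IHn F _ hF; first by rewrite -lF.
pose b : R := ((content k i F)%:~R - (content k j F)%:~R)^-1.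
have TE : T E = theta_act s (T F) - b *: T F.
  by case: hT => _ _ _ step; rewrite [in LHS]EF; apply: step.
have [e He] := hgen_swap ij jN (F :\ oN).
rewrite -/s -EFo in He.
exists (a * (-1) ^+ e); first by rewrite mulf_neq0 // signr_eq0.
have -> : T E - (a * (-1) ^+ e) *: hgen (E :\ oN) =
   theta_act s (T F - a *: hgen (F :\ oN)) - b *: T F.
  by rewrite TE linearB /= [theta_act s (_ *: _)]linearZ /= He scalerA addrAC.
rewrite lF; apply: hspanD; first exact: hspan_low_swap.
apply/hspanN/hspanZ.
rewrite -[T F](subrK (a *: hgen (F :\ oN))); apply: hspanD; first exact: hspan_low Ha.
by apply/hspanZ/hspan_gen; rewrite /low hook_arm // ltnSn.
Qed.

Lemma T_hspan E : E \in hooks -> hspan (hdeg hook_deg) (T E).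
Proof.
move=> hE; have [a _ Ha] := T_expand hE.
rewrite -[T E](subrK (a *: hgen (E :\ oN))); apply: hspanD; last first.
  by apply/hspanZ/hspan_gen/hook_arm.
by apply: (hspan_linear (f := idfun)) Ha => H /andP[dH _]; apply: hspan_gen.
Qed.

Local Notation hook_span := (hook_span m k T).

Lemma hook_span0 : hook_span 0.
Proof. by exists (fun=> 0); rewrite big1 // => H _; rewrite scale0r. Qed.

Lemma hook_spanD u v : hook_span u -> hook_span v -> hook_span (u + v).
Proof.
move=> [b ->] [c ->]; exists (fun F : {set 'I_N} => b F + c F); rewrite -big_split.
by apply: eq_bigr => H _; rewrite scalerDl.
Qed.

Lemma hook_spanZ a v : hook_span v -> hook_span (a *: v).
Proof.
move=> [b ->]; exists (fun F : {set 'I_N} => a * b F); rewrite scaler_sumr.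
by apply: eq_bigr => H _; rewrite scalerA.
Qed.

Lemma hook_span_sum (I : Type) (s : seq I) (Q : pred I) (f : I -> ext N R) :
  (forall x, Q x -> hook_span (f x)) -> hook_span (\sum_(x <- s | Q x) f x).
Proof. by move=> fP; apply: big_ind; [exact: hook_span0 | exact: hook_spanD |]. Qed.

Lemma hook_span_T F : F \in hooks -> hook_span (T F).
Proof.
move=> hF; exists (fun E : {set 'I_N} => (E == F)%:R).
rewrite (bigD1 F) //= eqxx scale1r big1 ?addr0 //.
by move=> E /andP[_ /negPf->]; rewrite scale0r.
Qed.

(** The expansion is triangular with nonzero diagonal, so it can be inverted. *)
Lemma hgen_hook_span H : hdeg hook_deg H -> hook_span (hgen H).
Proof.
have [n] := ubnP (level H); elim: n H => // n IHn H; rewrite ltnS => lH dH.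
have [E hE EH] := arm_hook dH; have [a a0 Ha] := T_expand hE.
have -> : hgen H = a^-1 *: (T E + (-1) *: (T E - a *: hgen (E :\ oN))).
  by rewrite scaleN1r opprB addrC subrK -EH scalerA mulVf ?scale1r.
apply/hook_spanZ/hook_spanD; first exact: hook_span_T.
apply: hook_spanZ; case: Ha => b ->; apply: hook_span_sum => F /andP[dF lF].
by apply/hook_spanZ/IHn => //; rewrite (leq_trans lF) // -EH.
Qed.

(** Both spans coincide, and the one of the products is visibly invariant. *)
Lemma hook_span_theta_act w v : hook_span v -> hook_span (theta_act w v).
Proof.
move=> [b ->].
have : hspan (hdeg hook_deg) (theta_act w (\sum_(F in hooks) b F *: T F)).
  by apply/hspan_theta_act/hspan_sum => F hF; apply/hspanZ/T_hspan.
by case=> c ->; apply: hook_span_sum => H dH; apply/hook_spanZ/hgen_hook_span.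
Qed.

End HookGenerators.

Section HookVectors.

Variables (N m : nat) (R : realFieldType) (k : bool).
Hypothesis hm : (1 <= m <= N.-1)%N.
Variable T : {set 'I_N} -> ext N R.
Hypothesis hT : hook_vectors m k T.

Implicit Types (E F : {set 'I_N}) (i : 'I_N) (v : ext N R) (w : 'S_N).

Local Notation hooks := (hook_sets N m k).
Local Notation hspan := (hook_span m k T).

Lemma hook_span_act w v : hspan v -> hspan (theta_act w v).
Proof.
have n1 : (N.-1 < N)%N by lia.
by apply: (hook_span_theta_act (oN := Ordinal n1)) => //=; lia.
Qed.

Lemma hook_span_degree v E : hspan v -> #|E| != m -> v E = 0.
Proof.
case: hT => Tm _ _ _ [b ->] cE; rewrite sum_ffunE big1 // => F hF.
by rewrite ffunE Tm ?mulr0.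
Qed.

Definition jucys_murphy i v : ext N R := \sum_(j < N | (i < j)%N) theta_act (tperm i j) v.

Lemma jucys_murphy_T F i (b : R) : F \in hooks ->
  jucys_murphy i (b *: T F) = (content k i F)%:~R *: (b *: T F).
Proof.
move=> hF; case: hT => _ /(_ F hF i) + _ _; rewrite scalerA mulrC -scalerA => <-.
by rewrite scaler_sumr; apply: eq_bigr => j _; rewrite linearZ.
Qed.

Lemma jucys_murphy_sum i (I : Type) (s : seq I) (P : pred I) (f : I -> ext N R) :
  jucys_murphy i (\sum_(x <- s | P x) f x) = \sum_(x <- s | P x) jucys_murphy i (f x).
Proof.
by rewrite /jucys_murphy [RHS]exchange_big /=; apply: eq_bigr => j _; rewrite linear_sum.
Qed.

(** Eigenvectors of the Jucys-Murphy elements for different content vectors are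
    independent.  The conclusion is about the summands because a T_F might vanish. *)
Lemma hook_independent (b : {set 'I_N} -> R) :
  \sum_(F in hooks) b F *: T F = 0 -> forall F, F \in hooks -> b F *: T F = 0.
Proof.
have gen (s : seq {set 'I_N}) (c : {set 'I_N} -> R) : uniq s -> {subset s <= hooks} ->
    \sum_(F <- s) c F *: T F = 0 -> {in s, forall F, c F *: T F = 0}.
  elim: s c => [//|G s IHs] c /= /andP[nG us] sub sum0.
  have hG : G \in hooks by apply: sub; rewrite inE eqxx.
  have hs F : F \in s -> F \in hooks by move=> Fs; apply: sub; rewrite inE Fs orbT.
  have tail0 F : F \in s -> c F *: T F = 0.
    move=> Fs; have [i ci] : exists i, content k i F != content k i G.
      apply/existsP; apply: contraT; rewrite negb_exists => /forallP FG.
      case/negP: nG; rewrite -(_ : F = G) //; apply: (@content_inj _ k) => i.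
      by apply/eqP; have := FG i; rewrite negbK.
    (* subtracting the eigenvalue of T_G from the i-th element removes T_G only *)
    pose d H : R := (content k i H)%:~R - (content k i G)%:~R.
    have sumd : \sum_(H <- G :: s) d H *: (c H *: T H) = 0.
      transitivity (jucys_murphy i (\sum_(H <- G :: s) c H *: T H)
          - (content k i G)%:~R *: \sum_(H <- G :: s) c H *: T H); last first.
        by rewrite sum0 scaler0 subr0 /jucys_murphy big1 // => j _; rewrite linear0.
      rewrite jucys_murphy_sum scaler_sumr -sumrB; apply: eq_big_seq => H Hs.
      by rewrite jucys_murphy_T ?sub // -scalerBl.
    have /(IHs (fun H => d H * c H) us hs)/(_ F Fs) : \sum_(H <- s) (d H * c H) *: T H = 0.
      rewrite -[RHS]sumd [RHS]big_cons {1}(_ : d G = 0) ?scale0r ?add0r; last exact: subrr.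
      by apply: eq_bigr => H _; rewrite scalerA.
    rewrite -scalerA => /eqP; rewrite scaler_eq0 subr_eq0 eqr_int (negPf ci) /=.
    exact/eqP.
  move=> F; rewrite inE => /predU1P[->|]; last exact: tail0.
  by move: sum0; rewrite big_cons [X in _ + X]big_seq big1 ?addr0.
move=> sum0 F hF; apply: (gen (enum hooks) b) => //; rewrite ?enum_uniq ?mem_enum //.
  by move=> E; rewrite mem_enum.
by rewrite -[RHS]sum0 -[in RHS]big_enum.
Qed.

End HookVectors.

(** * Joint eigenvectors and the action of neighbouring transpositions *)

Section Spectrum.

Variables (N m : nat) (R : realFieldType) (kappa : R) (k : bool).
Hypotheses (hm : (1 <= m <= N.-1)%N) (hkappa : generic N kappa).
Variable T : {set 'I_N} -> ext N R.
Hypothesis hT : hook_vectors m k T.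

Implicit Types (E F : {set 'I_N}) (i j l : 'I_N) (a b : 'X_{1..N}) (p q : spoly N R).

Local Notation hooks := (hook_sets N m k).
Local Notation hspan := (hook_span m k T).
Local Notation U := (cherednik kappa).

(** The eigenvalue of U_i on J_(a,E). *)
Definition eigval a E i : R := (a i)%:R + 1 + kappa * (content k (rank_perm a i) E)%:~R.

Lemma generic_neq0 : kappa != 0.
Proof. by have := @hkappa 0 N; rewrite mul0r; apply; lia. Qed.

(** If the integers c and d differed, kappa would be a fraction with denominator
    at most N. *)
Lemma generic_inj (x y : nat) (c d : int) : (`|c - d| < N)%N ->
  x%:R + kappa * c%:~R = y%:R + kappa * d%:~R -> x = y /\ c = d.
Proof.
move=> cdN xy; have [cd|ncd] := eqVneq c d.
  by move: xy; rewrite cd => /addIr/eqP; rewrite eqr_nat => /eqP.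
have cd0 : c%:~R - d%:~R != 0 :> R by rewrite -rmorphB /= intr_eq0 subr_eq0.
have kE : kappa * (c%:~R - d%:~R) = y%:R - x%:R.
  by apply/eqP; rewrite mulrBr subr_eq addrAC -subr_eq opprK; apply/eqP; rewrite -xy addrC.
(* kappa would be (y - x) / (c - d); the sign moves to the numerator *)
pose e : int := Num.sg (c - d) * (y%:Z - x%:Z).
suff eqk : kappa = e%:~R / (`|c - d|%N)%:R.
  have := @hkappa e `|c - d|%N; rewrite -eqk eqxx (ltnW cdN) andbT absz_gt0 subr_eq0 ncd.
  by move/(_ isT).
have -> : (`|c - d|%N)%:R = (Num.sg (c - d))%:~R * (c%:~R - d%:~R) :> R.
  by rewrite -rmorphB -rmorphM /= -normrEsg -abszE.
rewrite /e rmorphM rmorphB /= -kE.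
have s0 : (Num.sg (c - d))%:~R != 0 :> R by rewrite intr_eq0 sgr_eq0 subr_eq0.
by rewrite -mulf_div divff // mul1r mulfK.
Qed.

Lemma eigval_inj a b E F (w : 'S_N) : E \in hooks -> F \in hooks ->
  (forall i, eigval a E i = eigval b F (w i)) ->
  a = b#w /\ (forall i, content k (rank_perm a i) E = content k (rank_perm b (w i)) F).
Proof.
move=> hE hF ev; have H i := @generic_inj (a i) (b (w i)) _ _ (content_bound _ _ hE hF)
  (addIr 1 (etrans (etrans (addrAC _ _ _) (ev i)) (addrAC _ _ _))).
by split=> [|i]; [apply/mnmP=> i; rewrite mnmE; case: (H i) | case: (H i)].
Qed.

Definition hook_valued p : Prop := forall b, hspan (x_coef b p).

Lemma hook_valued0 : hook_valued 0.
Proof. by move=> b; rewrite raddf0; apply: hook_span0. Qed.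

Lemma hook_valuedD p q : hook_valued p -> hook_valued q -> hook_valued (p + q).
Proof. by move=> hp hq b; rewrite raddfD; apply: hook_spanD; [apply: hp | apply: hq]. Qed.

Lemma hook_valuedZ c p : hook_valued p -> hook_valued (c%:MP_[N] *: p).
Proof. by move=> hp b; rewrite x_coefZ; apply: hook_spanZ; apply: hp. Qed.

Lemma hook_valuedN p : hook_valued p -> hook_valued (- p).
Proof. by move=> hp; rewrite -scaleN1r -mpolyCN; apply: hook_valuedZ. Qed.

Lemma hook_valued_act w p : hook_valued p -> hook_valued (sym_act w p).
Proof. by move=> hp b; rewrite x_coef_sym_act; apply: hook_span_act. Qed.

Lemma hook_valued_degree p : hook_valued p -> forall E, #|E| != m -> p E = 0.
Proof.
move=> hp E cE; apply/mpolyP=> b; rewrite mcoeff0.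
by have := hook_span_degree hT (hp b) cE; rewrite ffunE.
Qed.

(** x^b occurs in p and no monomial of p is higher.  Other monomials may have the
    same height; [x_coef_cherednik_top] allows for them. *)
Definition top_of b p : Prop :=
  x_coef b p != 0 /\ (forall c, x_coef c p != 0 -> (height c <= height b)%N).

Lemma top_exists p : p != 0 -> exists b, top_of b p.
Proof.
move=> p0; pose d := \max_(E : {set 'I_N}) msize (p E).
have dE c : x_coef c p != 0 -> (mdeg c < d)%N.
  move=> cp; have [E pE] : exists E, (p E)@_c != 0.
    apply/existsP; apply: contraR cp; rewrite negb_exists => /forallP cp.
    by apply/eqP/ffunP=> E; rewrite !ffunE; apply/eqP; have := cp E; rewrite negbK.
  apply: leq_trans (leq_bigmax E); rewrite ltnNge; apply: contra pE => /msize_mdeg_ge.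
  by rewrite -mcoeff_eq0.
have [c cp] : exists c, x_coef c p != 0.
  have [E pE] : exists E, p E != 0.
    apply/existsP; apply: contraR p0; rewrite negb_exists => /forallP pE.
    by apply/eqP/ffunP=> E; apply/eqP; have := pE E; rewrite negbK ffunE.
  exists (mlead (p E)); apply: contraTneq (mlead_supp pE) => /ffunP/(_ E).
  by rewrite !ffunE => /eqP; rewrite mcoeff_eq0.
have [b bp bmax] := @arg_maxnP _ (BMultinom (dE c cp)) (fun b : 'X_{1..N < d} => x_coef b p != 0)
  (fun b : 'X_{1..N < d} => height b) cp.
exists b; split=> // c' c'p; exact: (bmax (BMultinom (dE c' c'p))).
Qed.

Definition eigen (z : 'I_N -> R) p : Prop := forall i, U i p = (z i)%:MP_[N] *: p.

(** The highest coefficient of a joint eigenvector is, up to a permutation, a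
    joint eigenvector of the Jucys-Murphy elements. *)
Lemma spectrum p (z : 'I_N -> R) b : hook_valued p -> eigen z p -> top_of b p ->
  exists2 F, F \in hooks & forall i, z i = eigval b F i.
Proof.
move=> hp ev [bp bmax]; set r := rank_perm b.
pose u := theta_act r (x_coef b p).
have u0 : u != 0.
  by apply: contraNneq bp => u0; rewrite -(theta_actVK r (x_coef b p)) -/u u0 linear0.
have [c uE] : hspan u by apply: hook_span_act; rewrite ?hp.
have evu i : (z i - (b i).+1%:R) *: u = kappa *: jucys_murphy (r i) u.
  have := congr1 (fun q => theta_act r (x_coef b q)) (ev i).
  rewrite x_coefZ x_coef_cherednik_top // linearD !linearZ /= -/u => /eqP.
  rewrite eq_sym addrC -subr_eq -scalerBl => /eqP ->; congr (_ *: _).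
  rewrite linear_sum /jucys_murphy [RHS](reindex_inj (@perm_inj _ r)) /=.
  apply: eq_big => [j|j _]; first by rewrite !rank_permE rank_ltE.
  by rewrite theta_act_comp conjgC tpermJ -theta_act_comp.
have sum0 i : \sum_(F in hooks) ((z i - eigval b F i) * c F) *: T F = 0.
  transitivity ((z i - (b i).+1%:R) *: u - kappa *: jucys_murphy (r i) u); last first.
    by rewrite evu subrr.
  rewrite {1 2}uE jucys_murphy_sum !scaler_sumr -sumrB; apply: eq_bigr => F hF.
  rewrite (jucys_murphy_T hT) // !scalerA -scalerBl; congr (_ *: _).
  by rewrite /eigval -natr1; ring.
have [F hF cF] : exists2 F, F \in hooks & c F *: T F != 0.
  apply/exists_inP; apply: contraR u0; rewrite negb_exists => /forallP cT.
  rewrite uE big1 // => F hF; apply/eqP.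
  by have := cT F; rewrite hF /= negbK.
exists F => // i; apply/eqP; rewrite -subr_eq0.
have := hook_independent hT (sum0 i) hF; rewrite -scalerA => /eqP.
by rewrite scaler_eq0 (negPf cF) orbF.
Qed.

(** The eigenvalues force the highest monomial to be x^a. *)
Lemma eigen_zero p a E : hook_valued p -> E \in hooks -> eigen (eigval a E) p ->
  x_coef a p = 0 -> p = 0.
Proof.
move=> hp hE ev ap; apply/eqP; apply: contraT => /top_exists[b bp].
have [F hF zE] := spectrum hp ev bp.
have [ab _] := @eigval_inj a b E F 1%g hE hF (fun i => etrans (zE i) (congr1 _ (esym (perm1 i)))).
by case: bp; rewrite -(mperm1 b) -ab ap eqxx.
Qed.

Lemma eigenB (z : 'I_N -> R) p q : eigen z p -> eigen z q -> eigen z (p - q).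
Proof.
move=> ep eq i; rewrite -scaleN1r -mpolyCN cherednikD cherednikZC ep eq.
by rewrite scalerDr !scalerA mulrC.
Qed.

Variable J : 'X_{1..N} -> {set 'I_N} -> spoly N R.
Hypothesis hJ : forall a E, E \in hooks -> is_nsjack m kappa k T a E (J a E).

Lemma jack_eigen a E : E \in hooks -> eigen (eigval a E) (J a E).
Proof. by move=> /(hJ a)[_ ev]. Qed.

Lemma jack_lead a E : E \in hooks ->
  x_coef a (J a E) = theta_act (rank_perm a)^-1%g (T E).
Proof.
move=> /(hJ a)[[v [_ ->]] _]; rewrite raddfD /= x_coefX eqxx scale1r raddf_sum /=.
rewrite big1 ?addr0 // => b ba; rewrite x_coefX; case: eqVneq ba => [->|_ _].
  by rewrite /comp_lt /dom_lt !eqxx.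
by rewrite scale0r.
Qed.

Lemma jack_hook_valued a E : E \in hooks -> hook_valued (J a E).
Proof.
move=> hE; have [[v [hv ->]] _] := hJ a hE.
move=> b; rewrite raddfD /= x_coefX (raddf_sum (x_coef b)) /=; apply: hook_spanD.
  by apply/hook_spanZ/hook_span_act => //; apply: hook_span_T.
by apply: hook_span_sum => c _; rewrite x_coefX; apply/hook_spanZ/hv.
Qed.

(** Every highest monomial of J_(a,E) has the exponent a, by its eigenvalues; this
    is the triangularity of J with respect to the height. *)
Lemma jack_support a E b : E \in hooks -> x_coef b (J a E) != 0 -> b != a ->
  (height b < height a)%N.
Proof.
move=> hE bJ nba; have J0 : J a E != 0.
  by apply: contraNneq bJ => ->; rewrite raddf0.
have top_eq c : top_of c (J a E) -> c = a.
  move=> tc; have [F hF zE] := spectrum (jack_hook_valued a hE) (jack_eigen a hE) tc.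
  have [] := @eigval_inj a c E F 1%g hE hF (fun i => etrans (zE i) (congr1 _ (esym (perm1 i)))).
  by rewrite mperm1.
have [c tc] := top_exists J0; have ca := top_eq c tc; rewrite -ca.
rewrite ltn_neqAle tc.2 // andbT; apply: contra nba => /eqP bc; apply/eqP/top_eq.
by split=> // d dJ; rewrite bc; apply: tc.2.
Qed.

Lemma jack_unique p a E : hook_valued p -> E \in hooks -> eigen (eigval a E) p ->
  x_coef a p = theta_act (rank_perm a)^-1%g (T E) -> p = J a E.
Proof.
move=> hp hE ev ap; apply/eqP; rewrite -subr_eq0; apply/eqP.
apply: (eigen_zero _ hE (eigenB ev (jack_eigen a hE))).
  by apply/hook_valuedD/hook_valuedN/jack_hook_valued.
by rewrite raddfB /= ap jack_lead // subrr.
Qed.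



Section Adjacent.

Variables (i j : 'I_N).
Hypothesis ij : j = i.+1 :> nat.

Local Notation s := (tperm i j).

Definition step_coef (z : 'I_N -> R) : R := kappa / (z i - z j).

(** With b = kappa / (z_i - z_j) the constant terms of the exchange relations are
    absorbed by the multiple of p. *)
Lemma eigen_step z p : z i != z j -> eigen z p ->
  eigen (fun l => z (s l)) (sym_act s p - (step_coef z)%:MP_[N] *: p).
Proof.
move=> zij ep l; rewrite -scaleNr -mpolyCN cherednikD cherednikZC ep.
have bE : kappa = step_coef z * (z i - z j) by rewrite /step_coef divfK // subr_eq0.
have [li|nli] := eqVneq l i.
  rewrite li tpermL.
  have -> : U i (sym_act s p) = (z j)%:MP_[N] *: sym_act s p + kappa%:MP_[N] *: p.
    by have := sym_act_cherednik_r kappa ij p; rewrite ep sym_actZC => ->; rewrite subrK.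
  rewrite [X in _%:MP *: _ + X%:MP *: p]bE.
  rewrite scalerDr -addrA !scalerA -scalerDl -!mpolyCM -mpolyCD; congr (_ + _%:MP *: _).
  by ring.
have [lj|nlj] := eqVneq l j.
  rewrite lj tpermR.
  have -> : U j (sym_act s p) = (z i)%:MP_[N] *: sym_act s p - kappa%:MP_[N] *: p.
    by have := sym_act_cherednik_l kappa ij p; rewrite ep sym_actZC => ->; rewrite addrK.
  rewrite -scaleNr -mpolyCN [X in _%:MP *: _ + (- X)%:MP *: p]bE.
  rewrite scalerDr -addrA !scalerA -scalerDl -!mpolyCM -mpolyCD; congr (_ + _%:MP *: _).
  by ring.
rewrite tpermD 1?eq_sym // -sym_act_cherednik_far // ep sym_actZC.
by rewrite [in RHS]scalerDr !scalerA [X in _ = _ + X *: _]mulrC.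
Qed.

Lemma eigval_adjacent_neq a E : E \in hooks -> a i != a j ->
  eigval a E i != eigval a E j.
Proof.
move=> hE; apply: contraNneq => zij.
have [-> //] := generic_inj (content_bound (rank_perm a i) (rank_perm a j) hE hE)
  (addIr 1 (etrans (etrans (addrAC _ _ _) zij) (addrAC _ _ _))).
Qed.

Lemma eigval_swap a E l : a i != a j -> eigval (a#s) E l = eigval a E (s l).
Proof. by move=> aij; rewrite /eigval (rank_perm_swap (erefl s) ij aij) permM mnmE. Qed.

(** s J_(a,E) - b J_(a,E) has the eigenvalues of J_(s a,E), and the same
    coefficient at x^(s a) because J_(a,E) has only lower monomials besides x^a. *)
Lemma jack_ascent a E : E \in hooks -> (a i < a j)%N ->
  sym_act s (J a E) = J (a#s) E + (step_coef (eigval a E))%:MP_[N] *: J a E.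
Proof.
move=> hE aij; have nij : a i != a j by rewrite neq_ltn aij.
have lt_ij : (i < j)%N by rewrite ij.
have hJa := jack_hook_valued a hE.
have zij := eigval_adjacent_neq hE nij.
have ev := eigen_step zij (jack_eigen a hE).
have <- : sym_act s (J a E) - (step_coef (eigval a E))%:MP_[N] *: J a E = J (a#s) E;
  last by rewrite subrK.
apply: jack_unique => //.
- by apply: hook_valuedD (hook_valued_act _ hJa) (hook_valuedN (hook_valuedZ _ hJa)).
- by move=> l; rewrite eigval_swap //; apply: ev.
rewrite raddfB /= x_coefZ x_coef_sym_act -mpermM tperm2 mperm1 jack_lead //.
have -> : x_coef (a#s) (J a E) = 0.
  apply/eqP; apply: contraT => /(jack_support hE).
  have lt := height_swap lt_ij aij; rewrite ltnNge (ltnW lt).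
  by case: eqVneq lt => [->|_ _ /(_ isT)] //; rewrite ltnn.
by rewrite scaler0 subr0 theta_act_comp (rank_perm_swap (erefl s) ij nij) invMg tpermV.
Qed.

Section Equal.

Variable a : 'X_{1..N}.
Hypothesis aij : a i = a j.

Local Notation ri := (rank_perm a i).
Local Notation rj := (rank_perm a j).
Local Notation s' := (tperm ri rj).

Lemma rank_perm_adjacent : rj = ri.+1 :> nat.
Proof. by rewrite !rank_permE (rank_adjacent ij aij). Qed.

Lemma mnm_swap_eq : a#s = a.
Proof. by apply/mnmP=> l; rewrite mnmE; case: tpermP => [->|->|]. Qed.

Lemma rank_perm_tperm l : rank_perm a (s l) = s' (rank_perm a l).
Proof. by rewrite -[LHS]permM [in LHS]conjgC tpermJ permM. Qed.

Lemma eigval_equal E : eigval a E i - eigval a E j =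
  kappa * ((content k ri E)%:~R - (content k rj E)%:~R).
Proof. by rewrite /eigval aij; ring. Qed.

(** Here z_i - z_j = kappa, so s J - J would be an eigenvector with the exchanged
    eigenvalues; no filling has the exchanged contents, so it vanishes. *)
Lemma jack_row E : E \in hooks -> in_row ri rj E -> sym_act s (J a E) = J a E.
Proof.
move=> hE row; have hJa := jack_hook_valued a hE.
have zd : eigval a E i - eigval a E j = kappa.
  by rewrite eigval_equal (content_row rank_perm_adjacent hE row) rmorphD /=; ring.
have zij : eigval a E i != eigval a E j by rewrite -subr_eq0 zd generic_neq0.
have := eigen_step zij (jack_eigen a hE).
rewrite /step_coef zd divff ?generic_neq0 // mpolyC1 scale1r => ev.
apply/eqP; rewrite -subr_eq0; apply: contraT => /top_exists[c tc].
have hv : hook_valued (sym_act s (J a E) - J a E).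
  by apply: hook_valuedD (hook_valued_act _ hJa) (hook_valuedN hJa).
have [F hF zF] := spectrum hv ev tc.
have [ca cF] := @eigval_inj c a F E s hF hE (fun l => esym (zF l)).
rewrite mnm_swap_eq in ca.
have : separated ri rj E.
  apply: (content_swap_separated rank_perm_adjacent hE hF) => l.
  by have := cF ((rank_perm a)^-1%g l); rewrite ca permKV rank_perm_tperm permKV.
by case/andP: row => /negPf iE; rewrite /separated iE; case: (rj \in E) => /=; rewrite ?andbF // => ->.
Qed.

(** On the coefficients at x^a, s acts as the transposition of the two entries of
    the tableau, and the recursion for T is exactly the resulting relation. *)
Lemma jack_upward E : E \in hooks -> rj.+1 != N -> upward ri rj k E ->
  sym_act s (J a E) = J a (s' @: E) +
    ((content k ri E)%:~R - (content k rj E)%:~R)^-1%:MP_[N] *: J a E.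
Proof.
move=> hE rjN up; have hJa := jack_hook_valued a hE.
have radj := rank_perm_adjacent.
have hsE : s' @: E \in hooks by apply: hook_swap.
have sep : (ri \in E) != (rj \in E).
  by move: up; rewrite /upward; case: k; case: (_ \in E); case: (_ \in E).
have d0 : (content k ri E)%:~R - (content k rj E)%:~R != 0 :> R.
  rewrite -rmorphB intr_eq0; have := content_upward radj hE rjN up.
  by case: (k) => h; apply/eqP; lia.
have zij : eigval a E i != eigval a E j.
  by rewrite -subr_eq0 eigval_equal mulf_neq0 ?generic_neq0.
have := eigen_step zij (jack_eigen a hE).
rewrite /step_coef eigval_equal invfM mulrA divff ?generic_neq0 // mul1r => ev.
set b := _^-1 in ev *.
have <- : sym_act s (J a E) - b%:MP_[N] *: J a E = J a (s' @: E); last by rewrite subrK.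
apply: jack_unique => //.
- by apply: hook_valuedD (hook_valued_act _ hJa) (hook_valuedN (hook_valuedZ _ hJa)).
- move=> l; have -> : eigval a (s' @: E) l = eigval a E (s l); last exact: ev.
  rewrite /eigval content_swap // rank_perm_tperm; congr (_%:R + _ + _).
  by case: tpermP => [->|->|].
rewrite raddfB /= x_coefZ x_coef_sym_act mnm_swap_eq jack_lead //.
case: hT => _ _ _ /(_ E hE ri rj radj up rjN) ->.
rewrite linearB /= [X in _ = _ - X]linearZ /= !theta_act_comp -/b.
by rewrite -tpermJ conjgE -!mulgA mulgV mulg1.
Qed.

End Equal.
End Adjacent.
End Spectrum.

(** * The coefficients of the symmetric combination *)

Section PairProducts.

Variables (N : nat) (R : comNzRingType).

Implicit Types (i j x y : 'I_N) (P : rel 'I_N) (f : 'I_N -> 'I_N -> R).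

Lemma pair_prod_act (s : 'S_N) P f :
  \prod_x \prod_(y | P x y) f x y = \prod_x \prod_(y | P (s x) (s y)) f (s x) (s y).
Proof.
rewrite (reindex_inj (@perm_inj _ s)); apply: eq_bigr => x _.
by rewrite (reindex_inj (@perm_inj _ s)).
Qed.

Lemma eq_pair_prod P P' f f' : (forall x y, P x y = P' x y) ->
  (forall x y, P x y -> f x y = f' x y) ->
  \prod_x \prod_(y | P x y) f x y = \prod_x \prod_(y | P' x y) f' x y.
Proof.
move=> PP' ff'; apply: eq_bigr => x _; apply: eq_big => [y|y Pxy]; first exact: PP'.
exact: ff'.
Qed.

Lemma pair_prodD1 i j P f : P i j -> \prod_x \prod_(y | P x y) f x y =
  f i j * \prod_x \prod_(y | P x y && ((x, y) != (i, j))) f x y.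
Proof.
move=> Pij; rewrite (bigD1 i) //= (bigD1 j) //= -mulrA; congr (_ * _).
rewrite [in RHS](bigD1 i) //=; congr (_ * _).
  by apply: eq_bigl => y; rewrite xpair_eqE eqxx.
by apply: eq_bigr => x xi; apply: eq_bigl => y; rewrite xpair_eqE (negPf xi) andbT.
Qed.

End PairProducts.

Lemma swap_ltn N (i j x y : 'I_N) : j = i.+1 :> nat -> (x, y) != (i, j) -> (x, y) != (j, i) ->
  (tperm i j x < tperm i j y)%N = (x < y)%N.
Proof.
rewrite !xpair_eqE !negb_and => ij.
have neqE (u v : 'I_N) : (u != v) = (u != v :> nat) by [].
rewrite !neqE.
by case: tpermP => [->|->|/eqP + /eqP +]; case: tpermP => [->|->|/eqP + /eqP +];
  rewrite ?neqE; lia.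
Qed.

Section Coefficients.

Variables (N m : nat) (R : realFieldType) (kappa : R) (k : bool).
Variables (i j : 'I_N).
Hypothesis ij : j = i.+1 :> nat.

Implicit Types (a : 'X_{1..N}) (E F : {set 'I_N}).

Local Notation hooks := (hook_sets N m k).
Local Notation s := (tperm i j).

(** The factor of the pair (i, j) is 1 + b; the others correspond under relabelling
    by the transposition. *)
Lemma R_prod_ascent a E : (a i < a j)%N ->
  R_prod kappa 1 k a E =
  (1 + step_coef kappa i j (eigval kappa k a E)) * R_prod kappa 1 k (a#s) E.
Proof.
move=> aij; have nij : a i != a j by rewrite neq_ltn aij.
rewrite /R_prod (@pair_prodD1 _ _ i j) ?ij ?ltnSn ?aij //; congr (_ * _).
  congr (1 + _); rewrite expr1 mulN1r mulNr -mulrN -invrN; congr (_ * _^-1).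
  by rewrite /eigval; ring.
rewrite [RHS](pair_prod_act s); apply: eq_pair_prod => x y; last first.
  by move=> _; rewrite !mnmE !tpermK (rank_perm_swap (erefl s) ij nij) !permM !tpermK.
rewrite !mnmE !tpermK.
have [[-> ->]|nxy] := eqVneq (x, y) (i, j).
  by rewrite tpermL tpermR ij andbF; apply/esym/negP => /andP[]; lia.
have [[-> ->]|nyx] := eqVneq (x, y) (j, i).
  by rewrite [(a j < a i)%N]ltnNge (ltnW aij) !andbF.
by rewrite andbT swap_ltn.
Qed.

Section Equal.

Variable a : 'X_{1..N}.
Hypothesis aij : a i = a j.

Local Notation ri := (rank_perm a i).
Local Notation rj := (rank_perm a j).
Local Notation s' := (tperm ri rj).

(** Contents are exchanged along equal values, which only permutes the factors. *)
Lemma R_prod_equal E : (ri \in E) != (rj \in E) ->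
  R_prod kappa 1 k a (s' @: E) = R_prod kappa 1 k a E.
Proof.
move=> sep; have radj := rank_perm_adjacent ij aij.
have as_eq x : a (s x) = a x by case: tpermP => [->|->|].
rewrite /R_prod [RHS](pair_prod_act s); apply: eq_pair_prod => x y; last first.
  by move=> _; rewrite !(content_swap radj) // !rank_perm_tperm !as_eq.
rewrite !as_eq.
have [[-> ->]|nxy] := eqVneq (x, y) (i, j); first by rewrite aij ltnn !andbF.
have [[-> ->]|nyx] := eqVneq (x, y) (j, i); first by rewrite aij ltnn !andbF.
by rewrite swap_ltn.
Qed.

End Equal.

(** The image of E has one more contributing pair, whose factor is 1 + 1 / d. *)
Lemma C_prod_upward E : j.+1 != N -> upward i j k E ->
  C_prod R 1 k (s @: E) =
  (1 + ((content k i E)%:~R - (content k j E)%:~R)^-1) * C_prod R 1 k E.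
Proof.
move=> jN up; have sep : (i \in E) != (j \in E).
  by move: up; rewrite /upward; case: k; case: (_ \in E); case: (_ \in E).
have [jl il] := (ltn_ord j, ltn_ord i).
have [jN' iN'] : (j.+1 < N)%N /\ (i.+1 < N)%N by lia.
have sN x : ((s x).+1 < N)%N = (x.+1 < N)%N.
  by case: tpermP => [->|->|//]; rewrite jN' iN'.
(* after relabelling, the pair (j, i) is the only new one *)
rewrite {1}/C_prod (pair_prod_act s) (@pair_prodD1 _ _ j i); last first.
  rewrite tpermL tpermR ij ltnSn -ij jN' !imset_swapE tpermL tpermR.
  by move: up; rewrite /upward; case: k => /andP[-> ->].
congr (_ * _).
  rewrite !(content_swap ij) // !tpermK; congr (1 + _).
  by rewrite expr1 mulN1r -invrN opprB.
apply: eq_pair_prod => x y; last first.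
  by move=> _; rewrite !(content_swap ij) // !tpermK.
rewrite !imset_swapE !tpermK sN.
have [[-> ->]|nxy] := eqVneq (x, y) (i, j).
  rewrite tpermL tpermR ij; move: up; rewrite /upward.
  by case: k => /andP[iE jE]; rewrite ?iE ?jE ?(negPf iE) ?(negPf jE) !andbF; lia.
have [[-> ->]|nyx] := eqVneq (x, y) (j, i).
  by rewrite andbF ij; apply/esym/negP => /and3P[]; lia.
by rewrite andbT swap_ltn.
Qed.

Definition jack_coef a E : R := R_prod kappa 1 k a E / C_prod R 1 k E.

Lemma jack_coef_ascent a E : (a i < a j)%N ->
  jack_coef a E = (1 + step_coef kappa i j (eigval kappa k a E)) * jack_coef (a#s) E.
Proof. by move=> aij; rewrite /jack_coef R_prod_ascent // mulrA. Qed.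

End Coefficients.

(** C_1 is in the denominator, so its factor 1 + 1 / d moves to the side of the
    exchanged set. *)
Lemma jack_coef_upward (N m : nat) (R : realFieldType) (kappa : R) (k : bool) (i j : 'I_N)
    (a : 'X_{1..N}) (E : {set 'I_N}) :
  j = i.+1 :> nat -> a i = a j -> E \in hook_sets N m k ->
  (rank_perm a j).+1 != N -> upward (rank_perm a i) (rank_perm a j) k E ->
  jack_coef kappa k a E =
  (1 + ((content k (rank_perm a i) E)%:~R - (content k (rank_perm a j) E)%:~R)^-1) *
  jack_coef kappa k a (tperm (rank_perm a i) (rank_perm a j) @: E).
Proof.
move=> ij aij hE rjN up; have radj := rank_perm_adjacent ij aij.
have sep : (rank_perm a i \in E) != (rank_perm a j \in E).
  by move: up; rewrite /upward; case: (k); case: (_ \in E); case: (_ \in E).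
rewrite /jack_coef R_prod_equal // (C_prod_upward _ radj rjN up).
have := content_upward radj hE rjN up; rewrite -rmorphB /=.
set d := (_ - _)%R => dP.
have u0 : 1 + (d%:~R)^-1 != 0 :> R.
  have d0 : d%:~R != 0 :> R by rewrite intr_eq0; apply/eqP; move: dP; case: (k); lia.
  rewrite -(inj_eq (mulfI d0)) mulr0 mulrDr mulr1 divff // -(intrD _ d 1) intr_eq0.
  by apply/eqP; move: dP; case: (k); lia.
by rewrite invfM [RHS]mulrCA mulVKf.
Qed.

(** * Tableaux and invariance *)

Section Tableaux.

Variables (N m : nat) (k : bool).

Implicit Types (a b : 'X_{1..N}) (E F A : {set 'I_N}) (i j l : 'I_N).

Local Notation hooks := (hook_sets N m k).

Lemma enum_swap i j A : j = i.+1 :> nat -> (i \in A) != (j \in A) ->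
  enum (tperm i j @: A) = [seq tperm i j l | l <- enum A].
Proof.
move=> ij sep; apply: enum_set_eq; last first.
  move=> l; rewrite imset_swapE; apply/idP/mapP => [lA|[x + ->]].
    by exists (tperm i j l); rewrite ?mem_enum // tpermK.
  by rewrite mem_enum tpermK.
rewrite sorted_map; apply: (@sub_in_sorted _ (mem A)) (sorted_enum_set A); last first.
  by apply/allP => l; rewrite mem_enum.
move=> x y xA yA xy /=; rewrite swap_ltn //.
  by apply: contraNneq sep => -[<- <-]; rewrite xA yA.
by apply: contraNneq sep => -[<- <-]; rewrite xA yA.
Qed.

Lemma tableau_swap a i j E : j = i.+1 :> nat -> (i \in E) != (j \in E) ->
  comp_sort a i = comp_sort a j -> tableau k a (tperm i j @: E) = tableau k a E.
Proof.
move=> ij sep aij.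
have sepC : (i \in ~: E) != (j \in ~: E) by rewrite !inE; case: (_ \in _) sep; case: (_ \in _).
have mapE (t : seq 'I_N) :
    [seq comp_sort a x | x <- [seq tperm i j l | l <- t]] = [seq comp_sort a x | x <- t].
  by rewrite -map_comp; apply: eq_map => x /=; case: tpermP => [->|->|].
rewrite /tableau /hook_filling -imset_swapC !enum_swap // -!map_rev.
by case: k; rewrite /= -map_take -map_cat !mapE.
Qed.

(** Each of row and column is read with the corner; leaving the corner out of one of
    them, every cell is read once, so the tableau contains the multiset of values. *)
Lemma tableau_sort a b E F : (0 < N)%N -> E \in hooks -> F \in hooks ->
  tableau k a E = tableau k b F -> comp_sort a = comp_sort b.
Proof.
move=> n0 hE hF tab.
pose cells (t : seq nat * seq nat) := if k then behead t.1 ++ t.2 else t.1 ++ behead t.2.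
have perm_cells c G : G \in hooks -> perm_eq (cells (tableau k c G)) c.
  move=> hG; have pG : perm_eq (rev (enum G) ++ rev (enum (~: G))) (enum 'I_N).
    apply: uniq_perm; rewrite ?enum_uniq //; last first.
      by move=> l; rewrite mem_cat !mem_rev !mem_enum inE orbN.
    rewrite cat_uniq !rev_uniq !enum_uniq andbT; apply/hasPn => l.
    by rewrite !mem_rev !mem_enum inE.
  have cellsE : cells (tableau k c G) = map (comp_sort c) (rev (enum G) ++ rev (enum (~: G))).
    have n1 : (N.-1 < N)%N by rewrite prednK.
    have last_mem : (Ordinal n1 \in G) = ~~ k by apply: (hook_last hG); rewrite /= prednK.
    have nonempty A : Ordinal n1 \in A -> exists x t, rev (enum A) = x :: t.
      by rewrite -mem_enum -mem_rev; case: (rev _) => // x t _; exists x, t.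
    rewrite /cells /tableau /hook_filling; case: (k) last_mem => /= last_mem.
      have [|x [t ->]] := nonempty (~: G); first by rewrite inE last_mem.
      by rewrite /= take0 /= map_cat.
    have [|x [t ->]] := nonempty G; first by rewrite last_mem.
    by rewrite /= take0 /= map_cat.
  rewrite cellsE; apply: perm_trans (perm_map _ pG) _; rewrite -mnm_seq.
  have -> : comp_sort c = c#(rank_perm c)^-1%g; last exact: mnm_perm.
  by apply/mnmP=> l; rewrite mnmE -[in LHS](permKV (rank_perm c) l) comp_sort_rank.
apply: perm_comp_sort; rewrite -(permPl (perm_cells a E hE)) tab.
exact: perm_cells.
Qed.

(** Two entries of the column with the same value contradict strictness; the corner
    has to be found as first cell of the column when it is not in E. *)
Lemma column_strict_swap a i j E : E \in hooks -> i != j -> in_col i j E ->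
  comp_sort a i = comp_sort a j -> column_strict (tableau k a E) = false.
Proof.
move=> hE nij /andP[iE col] aij; apply/negP; rewrite /column_strict /tableau /=.
set Y := (hook_filling k E).1 => uY.
have uniqY := map_uniq uY.
have EY l : l \in E -> l \in Y.
  by rewrite /Y /hook_filling; case: (k) => /= lE; rewrite ?mem_cat mem_rev mem_enum lE ?orbT.
have jY : j \in Y.
  have [/EY//|jE] := boolP (j \in E); move: col; rewrite (negPf jE) /= => /eqP jN.
  have := hook_last hE jN; rewrite (negPf jE) => /esym/negbFE kT.
  have jC : j \in ~: E by rewrite inE jE.
  by rewrite /Y /hook_filling kT (enum_last jN jC) rev_rcons /= inE eqxx.
have := perm_uniq (perm_map (comp_sort a) (perm_to_rem (EY i iE))).
rewrite uY /= => /esym/andP[/negP + _]; apply.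
by rewrite aij map_f // mem_rem_uniq // inE eq_sym nij.
Qed.

End Tableaux.

Section Generation.

Variables (N : nat) (R : comNzRingType) (p : spoly N R).

Lemma invariant_generated :
  (forall i j : 'I_N, j = i.+1 :> nat -> sym_act (tperm i j) p = p) ->
  forall w, sym_act w p = p.
Proof.
move=> Hadj; have HM u v : sym_act u p = p -> sym_act v p = p -> sym_act (u * v)%g p = p.
  by move=> Hu Hv; rewrite -sym_act_comp Hu.
have lt_case n (i j : 'I_N) : j = (i + n.+1)%N :> nat -> sym_act (tperm i j) p = p.
  elim: n j => [|n IHn] j jE; first by apply: Hadj; rewrite jE addn1.
  have lN : (i + n.+1 < N)%N by have := ltn_ord j; lia.
  pose l := Ordinal lN; have lj : j = l.+1 :> nat by rewrite jE /= addnS.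
  have -> : tperm i j = (tperm l j * (tperm i l * tperm l j))%g.
    have li : l != i by apply/eqP => /(congr1 val) /=; lia.
    have ji : j != i by apply/eqP => /(congr1 val) /=; lia.
    by have := tpermJ i l (tperm l j); rewrite conjgE tpermV tpermL (tpermD li ji) => <-.
  by apply: (HM _ _ (Hadj _ _ lj)); apply: (HM) (IHn _ _) (Hadj _ _ lj).
move=> w; have [ts -> _] := prod_tpermP w.
elim: ts => [|[i j] ts IHts]; first by rewrite big_nil sym_act1.
rewrite big_cons /=; apply: HM IHts.
have [ij|ji|/val_inj->] := ltngtP i j; last by rewrite tperm1 sym_act1.
  by apply: (lt_case (j - i.+1)%N); rewrite addnS -addSn subnKC.
by rewrite tpermC; apply: (lt_case (i - j.+1)%N); rewrite addnS -addSn subnKC.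
Qed.

End Generation.

(** The span of x and y is stable under the transposition, which acts on it by a
    matrix with square 1, and (A, B) is a fixed vector. *)
Lemma invariant_pair N (R : comNzRingType) (i j : 'I_N) (x y : spoly N R) (A B b : R) :
  sym_act (tperm i j) x = y + b%:MP_[N] *: x -> A = (1 + b) * B ->
  let z := A%:MP_[N] *: x + B%:MP_[N] *: y in sym_act (tperm i j) z = z.
Proof.
move=> sx -> z.
have sy : sym_act (tperm i j) y = x - b%:MP_[N] *: (y + b%:MP_[N] *: x).
  have -> : y = sym_act (tperm i j) x - b%:MP_[N] *: x by rewrite sx addrK.
  rewrite raddfB /= sym_actZC sym_act_comp tperm2 sym_act1 sx.
  by rewrite addrK.
rewrite /z raddfD /= !sym_actZC sy sx.
apply/ffunP=> E; rewrite !ffunE mpolyCM mpolyCD mpolyC1.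
by ring.
Qed.

(** * The supersymmetric Jack polynomial *)

Section Superjack.

Variables (N m : nat) (R : realFieldType) (kappa : R) (k : bool).
Hypotheses (hm : (1 <= m <= N.-1)%N) (hkappa : generic N kappa).
Variable T : {set 'I_N} -> ext N R.
Hypothesis hT : hook_vectors m k T.
Variable J : 'X_{1..N} -> {set 'I_N} -> spoly N R.
Hypothesis hJ : forall a E, E \in hook_sets N m k -> is_nsjack m kappa k T a E (J a E).
Variables (lam : 'X_{1..N}) (E0 : {set 'I_N}).
Hypotheses (hlam : is_partition lam) (hE0 : E0 \in hook_sets N m k).
Hypothesis hstrict : column_strict (tableau k lam E0).

Implicit Types (E F : {set 'I_N}) (i j l : 'I_N) (a b : 'X_{1..N}).

Local Notation hooks := (hook_sets N m k).
Local Notation index := ('X_{1..N < (mdeg lam).+1} * {set 'I_N})%type.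
Local Notation ST := (same_tableau m k lam E0).

Implicit Types (x : index).

Let Nge0 : (0 < N)%N. Proof. by case/andP: hm; case: (N) => [|//] m1 m0; have := leq_trans m1 m0. Qed.

Lemma same_tableauP x : reflect (x.2 \in hooks /\ tableau k x.1 x.2 = tableau k lam E0) (x \in ST).
Proof. by rewrite inE; apply: (iffP andP) => -[-> /eqP]. Qed.

Lemma same_tableau_sort x : x \in ST -> comp_sort x.1 = lam.
Proof.
case/same_tableauP => hx tx; apply: etrans (partition_sort hlam).
exact: (tableau_sort Nge0 hx hE0 tx).
Qed.

Section Partner.

Variables (i j : 'I_N).
Hypothesis ij : j = i.+1 :> nat.

Local Notation s := (tperm i j).

Fact mnm_swap_bound (a : 'X_{1..N < (mdeg lam).+1}) : (mdeg (a#s) < (mdeg lam).+1)%N.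
Proof. by rewrite mdeg_mperm bmdeg. Qed.

(** The pair whose J occurs in the action of the transposition on the J of x; x itself
    when that J is fixed. *)
Definition partner x : index :=
  let ri := rank_perm x.1 i in let rj := rank_perm x.1 j in
  if x.1 i != x.1 j then (BMultinom (mnm_swap_bound x.1), x.2)
  else if separated ri rj x.2 then (x.1, tperm ri rj @: x.2) else x.

Lemma partnerK : involutive partner.
Proof.
case=> a F; rewrite /partner /=; have [aij|naij] := eqVneq (a i) (a j); last first.
  rewrite /= !mnmE tpermL tpermR eq_sym naij; congr (_, _).
  by apply: val_inj; rewrite /= -mpermM tperm2 mperm1.
have [sep|nsep] := boolP (separated _ _ F); last by rewrite /= aij eqxx (negPf nsep).
rewrite /= aij eqxx /separated !imset_swapE tpermL tpermR [(rank_perm a j \in F) == _]eq_sym.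
by move: sep; rewrite /separated => ->; rewrite imset_swapK.
Qed.

Lemma partner_same_tableau x : (partner x \in ST) = (x \in ST).
Proof.
have sub y : y \in ST -> partner y \in ST.
  case: y => a F /same_tableauP[/= hF tF]; apply/same_tableauP; rewrite /partner /=.
  have [aij|naij] := eqVneq (a i) (a j); last by rewrite /= /tableau comp_sort_perm.
  have [/andP[rjN sep]|//] := boolP (separated _ _ F).
  have radj := rank_perm_adjacent ij aij.
  by rewrite /= hook_swap // tableau_swap // !comp_sort_rank.
by apply/idP/idP; [rewrite -{2}(partnerK x); apply: sub | apply: sub].
Qed.

Let term a F : spoly N R := (jack_coef kappa k a F)%:MP_[N] *: J a F.

Let ascent a F : F \in hooks -> (a i < a j)%N ->
  sym_act s (term a F + term (a#s) F) = term a F + term (a#s) F.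
Proof.
move=> hF aij; apply: invariant_pair (jack_coef_ascent kappa k ij F aij).
exact: (jack_ascent hm hkappa hT hJ).
Qed.

Let upward_pair a F : a i = a j -> F \in hooks -> (rank_perm a j).+1 != N ->
  upward (rank_perm a i) (rank_perm a j) k F ->
  let F' := tperm (rank_perm a i) (rank_perm a j) @: F in
  sym_act s (term a F + term a F') = term a F + term a F'.
Proof.
move=> aij hF rjN up; apply: invariant_pair (jack_coef_upward kappa ij aij hF rjN up).
exact: (jack_upward hm hkappa hT hJ).
Qed.

Lemma partner_invariant x : x \in ST ->
  sym_act s (term x.1 x.2 + term (partner x).1 (partner x).2) =
  term x.1 x.2 + term (partner x).1 (partner x).2.
Proof.
case: x => a F /same_tableauP[/= hF tF]; rewrite /partner /=.
have [aij|naij] := eqVneq (a i) (a j); last first.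
  have [lt_ij|lt_ji|eq_ij] := ltngtP (a i) (a j); last by rewrite eq_ij eqxx in naij.
    exact: ascent.
  have := @ascent (a#s) F hF; rewrite !mnmE tpermL tpermR -mpermM tperm2 mperm1 addrC.
  exact.
have radj := rank_perm_adjacent ij aij.
have [/andP[rjN sep]|nsep] := boolP (separated _ _ F).
  have [up|nup] := boolP (upward (rank_perm a i) (rank_perm a j) k F).
    exact: upward_pair.
  have hF' := hook_swap radj hF rjN.
  have := upward_pair aij hF' rjN; rewrite /= imset_swapK addrC; apply.
  move: nup sep; rewrite /upward !imset_swapE tpermL tpermR.
  by case: k; case: (_ \in F); case: (_ \in F).
have := adjacent_trichotomy (rank_perm a i) (rank_perm a j) F.
rewrite (negPf nsep) /= => /orP[row|col].
  by rewrite raddfD /= sym_actZC (jack_row hm hkappa hT hJ ij aij hF row).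
have neq_r : rank_perm a i != rank_perm a j.
  by rewrite (inj_eq perm_inj); apply/eqP => /(congr1 val) /=; lia.
have := @column_strict_swap N m k a _ _ F hF neq_r col; rewrite !comp_sort_rank => /(_ aij).
by rewrite tF hstrict.
Qed.

Lemma superjack_adjacent : sym_act s (superjack m kappa k J lam E0) = superjack m kappa k J lam E0.
Proof.
set p := superjack _ _ _ _ _ _.
have pE : p = \sum_(x in ST) term x.1 x.2 by [].
have p2 : p + p = \sum_(x in ST) (term x.1 x.2 + term (partner x).1 (partner x).2).
  rewrite big_split -pE /=; congr (_ + _); rewrite pE (reindex_inj (inv_inj partnerK)) /=.
  by apply: eq_bigl => x; rewrite partner_same_tableau.
have sp2 : sym_act s (p + p) = p + p.
  by rewrite p2 (raddf_sum (sym_act s)); apply: eq_bigr => x /partner_invariant.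
(* pairing every summand with its partner counts the sum twice *)
have half : p = (2%:R^-1)%:MP_[N] *: (p + p).
  rewrite -mulr2n -scaler_nat scalerA -mpolyC_nat -mpolyCM mulVf ?pnatr_eq0 //.
  by rewrite mpolyC1 scale1r.
by rewrite {1}half sym_actZC sp2 -half.
Qed.

End Partner.

Lemma term_hook_valued (e : R) a F : F \in hooks -> hook_valued m k T (e%:MP_[N] *: J a F).
Proof. by move=> hF; apply/hook_valuedZ/(jack_hook_valued hm hT hJ). Qed.

Lemma sum_hook_valued (e : index -> R) :
  hook_valued m k T (\sum_(x in ST) (e x)%:MP_[N] *: J x.1 x.2).
Proof.
apply: big_ind => [||x /same_tableauP[hx _]]; [exact: hook_valued0 | exact: hook_valuedD |].
exact: term_hook_valued.
Qed.

Lemma superjack_supersymmetric : supersymmetric m (superjack m kappa k J lam E0).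
Proof.
split; last by apply: invariant_generated => i j; apply: superjack_adjacent.
by apply: (hook_valued_degree hT); apply: (sum_hook_valued (fun x => jack_coef kappa k x.1 x.2)).
Qed.

(** J_(b,F) with b different from a contains x^a only if b is higher than a. *)
Lemma x_coef_sum_top (e : index -> R) (a : 'X_{1..N < (mdeg lam).+1}) :
  (forall x, x \in ST -> (e x)%:MP_[N] *: J x.1 x.2 != 0 -> (height x.1 <= height a)%N) ->
  x_coef a (\sum_(x in ST) (e x)%:MP_[N] *: J x.1 x.2) =
  theta_act (rank_perm a)^-1%g (\sum_(F | (a, F) \in ST) e (a, F) *: T F).
Proof.
move=> top; rewrite raddf_sum /=.
transitivity (\sum_(x | (x.1 == a) && (x \in ST)) e x *: x_coef a (J x.1 x.2)).
  rewrite [RHS]big_mkcondl /=; apply: eq_bigr => x xST; rewrite x_coefZ.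
  have [//|nxa] := eqVneq x.1 a.
  apply/eqP; apply: contraT => cx; have [hx _] := same_tableauP x xST.
  have Jx : x_coef a (J x.1 x.2) != 0 by apply: contraNneq cx => ->; rewrite scaler0.
  have := jack_support hm hkappa hT hJ hx Jx; rewrite eq_sym -(inj_eq val_inj) in nxa.
  move/(_ nxa); rewrite ltnNge => /negP[]; apply: top => //.
  by apply: contraNneq cx => e0; rewrite -x_coefZ e0 raddf0.
rewrite [RHS]linear_sum /= (reindex_onto (fun F => (a, F)) snd) /=; last first.
  by case=> b F /= /andP[/eqP-> _].
apply: eq_big => [F|F /andP[/andP[_ /same_tableauP[hF _]] _]]; first by rewrite !eqxx andbT.
by rewrite (jack_lead hJ _ hF) linearZ.
Qed.

Fact lam_bound : (mdeg lam < (mdeg lam).+1)%N.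
Proof. exact: ltnSn. Qed.

Let blam : 'X_{1..N < (mdeg lam).+1} := BMultinom lam_bound.

Lemma height_same_tableau x : x \in ST -> (height x.1 <= height lam)%N.
Proof.
move=> /same_tableau_sort xl; have [->//|nx] := eqVneq (bmnm x.1) lam.
exact/ltnW/height_max.
Qed.

Lemma superjack_lead : x_coef lam (superjack m kappa k J lam E0) = lead_vector m k T lam E0.
Proof.
rewrite (@x_coef_sum_top (fun x => jack_coef kappa k x.1 x.2) blam); last first.
  by move=> x xST _; apply: height_same_tableau.
rewrite /= partition_rank // invg1 theta_act1 /lead_vector.
apply: eq_big => [F|F _]; first by rewrite inE.
congr (_ *: _); rewrite /jack_coef /= -[RHS]mul1r; congr (_ * _).
rewrite /R_prod big1 // => i _; rewrite big1 // => j /andP[ij].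
by rewrite ltnNge hlam // ltnW.
Qed.

(** A symmetric combination whose coefficient at x^lam vanishes is zero: the
    highest monomial occurring in it can be moved to x^lam by a permutation. *)
Lemma sum_jack_eq0 (e : index -> R) (q : spoly N R) :
  q = \sum_(x in ST) (e x)%:MP_[N] *: J x.1 x.2 -> (forall w, sym_act w q = q) ->
  x_coef lam q = 0 -> q = 0.
Proof.
move=> qE qsym qlam; pose nz x := (x \in ST) && ((e x)%:MP_[N] *: J x.1 x.2 != 0).
have [/existsP[x0 nx0]|] := boolP [exists x, nz x]; last first.
  rewrite negb_exists qE => /forallP nz0; rewrite big1 // => x xST.
  by apply/eqP; have := nz0 x; rewrite /nz xST /= negbK.
have [[a F] /andP[xST nzJ] xmax] := arg_maxnP (fun x => height x.1) nx0.
have [hF _] := same_tableauP _ xST.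
have := @x_coef_sum_top e a; rewrite -qE => top.
have aE : a = lam#(rank_perm a) :> 'X_{1..N}.
  exact: rearrange_sort hlam (same_tableau_sort xST).
have qa : x_coef a q = 0.
  rewrite aE -[x_coef _ _](theta_actVK (rank_perm a)) -x_coef_sym_act qsym qlam.
  by rewrite linear0.
have sum0 : \sum_(G | (a, G) \in ST) e (a, G) *: T G = 0.
  rewrite -[LHS](theta_actK (rank_perm a)) -top ?qa ?linear0 // => x xS xnz.
  by apply: xmax; rewrite /nz xS.
have eT : e (a, F) *: T F = 0.
  have := @hook_independent _ _ _ _ _ hT (fun G => if (a, G) \in ST then e (a, G) else 0) _ F hF.
  rewrite xST; apply; rewrite -[RHS]sum0 [RHS]big_mkcond /= [LHS]big_mkcond /=.
  apply: eq_bigr => G _; case: ifP => [hG|/negbT nG].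
    by case: ifP; rewrite ?scale0r.
  by case: ifP => // /same_tableauP[/=]; rewrite (negPf nG).
case/negP: nzJ; apply/eqP/(eigen_zero hm hkappa hT (term_hook_valued _ a hF) hF).
  by move=> i; rewrite cherednikZC (jack_eigen hJ a hF) !scalerA mulrC.
by rewrite x_coefZ (jack_lead hJ _ hF) -linearZ /= eT linear0.
Qed.

End Superjack.

Theorem theorem8 (R : realFieldType) (N m : nat) (kappa : R)
    (hN : (2 <= N)%N) (hm : (1 <= m <= N.-1)%N) (hkappa : generic N kappa)
    (k : bool)
    (T : {set 'I_N} -> ext N R) (hT : hook_vectors m k T)
    (J : 'X_{1..N} -> {set 'I_N} -> spoly N R)
    (hJ : forall (alpha : 'X_{1..N}) (E : {set 'I_N}),
        E \in hook_sets N m k -> is_nsjack m kappa k T alpha E (J alpha E))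
    (lambda : 'X_{1..N}) (hlambda : is_partition lambda)
    (E : {set 'I_N}) (hE : E \in hook_sets N m k)
    (hstrict : column_strict (tableau k lambda E)) :
  let p := superjack m kappa k J lambda E in
  [/\ supersymmetric m p,
      nsjack_span m k J lambda E p,
      x_coef lambda p = lead_vector m k T lambda E
    & forall q : spoly N R,
        supersymmetric m q ->
        nsjack_span m k J lambda E q ->
        x_coef lambda q = lead_vector m k T lambda E ->
        q = p].
Proof.
move=> p; have psym := superjack_supersymmetric hm hkappa hT hJ hE hstrict.
have plead := superjack_lead hm hkappa hT hJ hlambda hE.
split=> [|||q [_ qsym] [b qE] qlead] //; first by exists (jack_coef kappa k).
apply/eqP; rewrite -subr_eq0; apply/eqP.
apply: (sum_jack_eq0 hm hkappa hT hJ hlambda hE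
          (e := fun x => b x.1 x.2 - jack_coef kappa k x.1 x.2)).
- rewrite qE /p /superjack -sumrB; apply: eq_bigr => x _.
  by rewrite mpolyCB scalerBl.
- by move=> w; rewrite raddfB /= qsym psym.2.
by rewrite raddfB /= qlead plead subrr.
Qed.
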